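(* Let $\{\rho^{B_1B_2}_{x_1,x_2}\}_{x_1\in\mathcal{X}_1,x_2\in\mathcal{X}_2}$ be a classical-quantum interference channel with finite input alphabets. Define $\mathcal{R}_{\mathrm{Sato}}$ as the union, over finite sets $\mathcal{Q}$ and input distributions of the form $p_Q(q)p_{X_1|Q}(x_1|q)p_{X_2|Q}(x_2|q)$, of the sets of rate pairs $(R_1,R_2)$ satisfying $$R_1\le I(X_1;B_1|X_2Q)_\theta,\quad R_2\le I(X_2;B_2|X_1Q)_\theta,\quad R_1+R_2\le I(X_1X_2;B_1B_2|Q)_\theta,$$ where $\theta=\sum_{q,x_1,x_2}p_Q(q)p_{X_1|Q}(x_1|q)p_{X_2|Q}(x_2|q)|q\rangle\langle q|^Q\otimes|x_1\rangle\langle x_1|^{X_1}\otimes|x_2\rangle\langle x_2|^{X_2}\otimes\rho^{B_1B_2}_{x_1,x_2}$. Then the capacity region of the interference channel is contained in $\mathcal{R}_{\mathrm{Sato}}$.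
   Context: A cc-qq interference channel maps classical inputs $(x_1,x_2)$ to a state $\rho^{B_1B_2}_{x_1,x_2}$ on finite-dimensional $\mathcal{H}^{B_1}\otimes\mathcal{H}^{B_2}$; used $n$ times memorylessly it outputs the tensor product state. An $(n,R_1,R_2,\epsilon)$ code consists of codebooks $\{x_1^n(m_1)\}$, $\{x_2^n(m_2)\}$ with $|\mathcal{M}_i|=2^{nR_i}$, a POVM $\{\Lambda_{m_1}\}$ on $B_1^n$ and a POVM $\{\Gamma_{m_2}\}$ on $B_2^n$, with average error $\frac{1}{|\mathcal{M}_1||\mathcal{M}_2|}\sum_{m_1,m_2}\mathrm{Tr}\{(I-\Lambda_{m_1}\otimes\Gamma_{m_2})\rho_{x_1^n(m_1),x_2^n(m_2)}\}\le\epsilon$. A rate pair is achievable if for all $\epsilon,\delta>0$ and sufficiently large $n$ an $(n,R_1-\delta,R_2-\delta,\epsilon)$ code exists; the capacity region is the closure of the set of achievable rate pairs. Information quantities are von Neumann-entropy based. *)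

(* Defs.v *)
From HB Require Import structures.
From mathcomp Require Import all_boot all_order all_algebra.
From mathcomp Require Import spectral.
From mathcomp Require Import complex.
From mathcomp Require Import classical_sets boolp reals topology normedtype exp.

Set Implicit Arguments.
Unset Strict Implicit.
Unset Printing Implicit Defensive.

Import Order.TTheory GRing.Theory Num.Theory.
Import numFieldNormedType.Exports.
Local Open Scope ring_scope.
Local Open Scope classical_set_scope.

Section QInfo.
Variable R : realType.
Local Notation C := R[i].

Definition RtoC (x : R) : C := (x%:C)%C.

(** Operators on the Hilbert space C^I with a finite orthonormal basis
    indexed by the finType I (matrices indexed by I). *)
Definition op (I : finType) := I -> I -> C.

Definition idop (I : finType) : op I := fun i j => (i == j)%:R.
Definition subop (I : finType) (A B : op I) : op I := fun i j => A i j - B i j.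
Definition mulop (I : finType) (A B : op I) : op I :=
  fun i j => \sum_(k : I) A i k * B k j.
Definition trace (I : finType) (A : op I) : C := \sum_(i : I) A i i.
Definition tensop (I K : finType) (A : op I) (B : op K) : op (I * K)%type :=
  fun ik jl => A ik.1 jl.1 * B ik.2 jl.2.

(* Positive semidefinite: <v, A v> >= 0 for all v (over C this forces
   A to be Hermitian). *)
Definition psd (I : finType) (A : op I) : Prop :=
  forall v : I -> C, 0 <= \sum_(i : I) \sum_(j : I) (v i)^* * A i j * v j.
Definition density (I : finType) (A : op I) : Prop :=
  psd A /\ trace A = 1.
Definition povm (M I : finType) (L : M -> op I) : Prop :=
  (forall m, psd (L m)) /\ (forall i j, \sum_(m : M) L m i j = idop i j).

(* Partial trace after a relabelling of the registers:
   f : T -> S * D should be a bijection identifying the system T with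
   S (x) D; ptr f A is the reduced operator on S (D traced out). *)
Definition ptr (T S D : finType) (f : T -> S * D) (A : op T) : op S :=
  fun s s' => \sum_(d : D) \sum_(t : T | f t == (s, d))
                \sum_(t' : T | f t' == (s', d)) A t t'.

(** von Neumann entropy (base 2): S(A) = - Tr A log2 A, computed from the
    eigenvalues of A (spectral decomposition, mathcomp's spectral_diag),
    with the convention 0 log 0 = 0. *)
Definition mxop (I : finType) (A : op I) : 'M[C]_#|I| :=
  \matrix_(i, j) A (enum_val i) (enum_val j).
Definition eta2 (x : R) : R := if 0 < x then x * (ln x / ln 2) else 0.
Definition vN_entropy (I : finType) (A : op I) : R :=
  - \sum_(k < #|I|) eta2 (complex.Re (spectral_diag (mxop A) 0 k)).

Definition pmf (T : finType) (p : T -> R) : Prop :=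
  (forall x, 0 <= p x) /\ \sum_(x : T) p x = 1.

(** The cc-qq interference channel: rho x1 x2 is a state on B1 B2, with
    H^{B1} = C^J1, H^{B2} = C^J2. *)
Definition cq_ic (X1 X2 J1 J2 : finType) (rho : X1 -> X2 -> op (J1 * J2)%type) :=
  forall x1 x2, density (rho x1 x2).

Section Theta.
Variables (X1 X2 J1 J2 Q : finType) (rho : X1 -> X2 -> op (J1 * J2)%type).
Variables (pQ : Q -> R) (p1 : Q -> X1 -> R) (p2 : Q -> X2 -> R).

Definition Treg := (Q * X1 * X2 * (J1 * J2))%type.

Definition theta : op Treg := fun t t' =>
  let: (q, x1, x2, b) := t in
  let: (q', x1', x2', b') := t' in
  if [&& q == q', x1 == x1' & x2 == x2']
  then RtoC (pQ q * p1 q x1 * p2 q x2) * rho x1 x2 b b'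
  else 0.

Definition Hth (S D : finType) (f : Treg -> S * D) : R :=
  vN_entropy (ptr f theta).

Definition k_QX1X2 (t : Treg) : (Q * X1 * X2) * (J1 * J2) :=
  let: (q, x1, x2, b) := t in ((q, x1, x2), b).
Definition k_QX2B1 (t : Treg) : (Q * X2 * J1) * (X1 * J2) :=
  let: (q, x1, x2, b) := t in ((q, x2, b.1), (x1, b.2)).
Definition k_QX1X2B1 (t : Treg) : (Q * X1 * X2 * J1) * J2 :=
  let: (q, x1, x2, b) := t in ((q, x1, x2, b.1), b.2).
Definition k_QX2 (t : Treg) : (Q * X2) * (X1 * J1 * J2) :=
  let: (q, x1, x2, b) := t in ((q, x2), (x1, b.1, b.2)).
Definition k_QX1B2 (t : Treg) : (Q * X1 * J2) * (X2 * J1) :=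
  let: (q, x1, x2, b) := t in ((q, x1, b.2), (x2, b.1)).
Definition k_QX1X2B2 (t : Treg) : (Q * X1 * X2 * J2) * J1 :=
  let: (q, x1, x2, b) := t in ((q, x1, x2, b.2), b.1).
Definition k_QX1 (t : Treg) : (Q * X1) * (X2 * J1 * J2) :=
  let: (q, x1, x2, b) := t in ((q, x1), (x2, b.1, b.2)).
Definition k_QB1B2 (t : Treg) : (Q * (J1 * J2)) * (X1 * X2) :=
  let: (q, x1, x2, b) := t in ((q, b), (x1, x2)).
Definition k_all (t : Treg) : Treg * unit := (t, tt).
Definition k_Q (t : Treg) : Q * (X1 * X2 * (J1 * J2)) :=
  let: (q, x1, x2, b) := t in (q, (x1, x2, b)).

(* Conditional mutual information I(A;B|C) = H(AC) + H(BC) - H(ABC) - H(C). *)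
Definition I_X1_B1_gX2Q : R :=
  Hth k_QX1X2 + Hth k_QX2B1 - Hth k_QX1X2B1 - Hth k_QX2.
Definition I_X2_B2_gX1Q : R :=
  Hth k_QX1X2 + Hth k_QX1B2 - Hth k_QX1X2B2 - Hth k_QX1.
Definition I_X1X2_B1B2_gQ : R :=
  Hth k_QX1X2 + Hth k_QB1B2 - Hth k_all - Hth k_Q.
End Theta.

Definition sato_region (X1 X2 J1 J2 : finType)
    (rho : X1 -> X2 -> op (J1 * J2)%type) : set (R * R)%type :=
  [set r | exists (Q : finType) (pQ : Q -> R) (p1 : Q -> X1 -> R)
             (p2 : Q -> X2 -> R),
     [/\ pmf pQ, (forall q, pmf (p1 q)) & (forall q, pmf (p2 q))] /\
     [/\ r.1 <= I_X1_B1_gX2Q rho pQ p1 p2,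
         r.2 <= I_X2_B2_gX1Q rho pQ p1 p2 &
         r.1 + r.2 <= I_X1X2_B1B2_gQ rho pQ p1 p2]].

(** n uses of the channel.  The output system B1^n B2^n has basis indexed by
    (J1^n) * (J2^n); the state is the tensor product of the
    rho_{x1_i, x2_i} (with the canonical identification
    (B1 B2)^{(x) n} = B1^n (x) B2^n). *)
Definition chan_n (X1 X2 J1 J2 : finType) (rho : X1 -> X2 -> op (J1 * J2)%type)
    (n : nat) (x1s : 'I_n -> X1) (x2s : 'I_n -> X2) :
    op ({ffun 'I_n -> J1} * {ffun 'I_n -> J2})%type :=
  fun a b => \prod_(k < n) rho (x1s k) (x2s k) (a.1 k, a.2 k) (b.1 k, b.2 k).

Definition code_error (X1 X2 J1 J2 : finType) (rho : X1 -> X2 -> op (J1 * J2)%type)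
    (n M1 M2 : nat) (e1 : 'I_M1 -> 'I_n -> X1) (e2 : 'I_M2 -> 'I_n -> X2)
    (L : 'I_M1 -> op {ffun 'I_n -> J1}) (G : 'I_M2 -> op {ffun 'I_n -> J2}) : C :=
  RtoC (M1 * M2)%:R^-1 *
  \sum_(m1 < M1) \sum_(m2 < M2)
     trace (mulop (subop (@idop _) (tensop (L m1) (G m2)))
                  (chan_n rho (e1 m1) (e2 m2))).

Definition code_exists (X1 X2 J1 J2 : finType) (rho : X1 -> X2 -> op (J1 * J2)%type)
    (n : nat) (R1 R2 eps : R) : Prop :=
  exists (M1 M2 : nat) (e1 : 'I_M1 -> 'I_n -> X1) (e2 : 'I_M2 -> 'I_n -> X2)
         (L : 'I_M1 -> op {ffun 'I_n -> J1}) (G : 'I_M2 -> op {ffun 'I_n -> J2}),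
    [/\ powR 2 (n%:R * R1) <= M1%:R, powR 2 (n%:R * R2) <= M2%:R,
        povm L, povm G & code_error rho e1 e2 L G <= RtoC eps].

Definition achievable (X1 X2 J1 J2 : finType) (rho : X1 -> X2 -> op (J1 * J2)%type)
    (r : (R * R)%type) : Prop :=
  forall eps delta : R, 0 < eps -> 0 < delta ->
    exists N : nat, forall n : nat, (N <= n)%N ->
      code_exists rho n (r.1 - delta) (r.2 - delta) eps.

Definition capacity_region (X1 X2 J1 J2 : finType)
    (rho : X1 -> X2 -> op (J1 * J2)%type) : set (R * R)%type :=
  closure [set r | achievable rho r].

End QInfo.

(* Main.v *)
(** The converse rests on the Nussbaum-Szkola reduction instead of Holevo's bound.
    For spectral decompositions s = sum_i lam_i |a_i><a_i| and
    w = sum_j mu_j |b_j><b_j|, the classical distributions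
    P_ij = lam_i |<a_i|b_j>|^2 and Q_ij = mu_j |<a_i|b_j>|^2 have relative entropy
    D(s || w), and a quantum test between s and w is at most a factor 2 better
    than the best classical test between P and Q.  Each codeword state is tested
    against the product, over the channel uses, of the averages over the codebook
    of the one-letter output states: the log-likelihood ratio is then additive and
    its mean over the codebook is a sum of one-letter Holevo quantities, so
    Markov's inequality gives log(eps M)(1 - 4 eps) <= 1 + sum_k chi_k in nats.
    With the channel use k as time-sharing variable (Q = {0,..,n-1}, uniform),
    every point of the capacity region is a limit of points of the Sato region.
    The Sato region is closed: the time-sharing alphabet can be cut down to 4
    letters (Caratheodory), the parameters then form a compact set, and the
    three mutual informations are upper semicontinuous by Klein's inequality. *)

Require Import Defs.
From HB Require Import structures.
From mathcomp Require Import all_boot all_order all_algebra.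
From mathcomp Require Import spectral complex.
From mathcomp Require Import classical_sets boolp reals topology normedtype sequences exp.
From mathcomp Require Import ring lra.

Set Implicit Arguments.
Unset Strict Implicit.
Unset Printing Implicit Defensive.

Import Order.TTheory GRing.Theory Num.Theory.
Import numFieldNormedType.Exports.
Local Open Scope ring_scope.
Local Open Scope classical_set_scope.

(** * Operators and orthonormal bases *)

Section HilbertSpace.
Variable R : realType.
Local Notation C := R[i].
Local Notation RtoC := (@RtoC R).

HB.instance Definition _ := GRing.RMorphism.copy RtoC (real_complex R).

Lemma RtoC_inj : injective RtoC.
Proof. exact: complexI. Qed.

Lemma ler_RtoC (x y : R) : (RtoC x <= RtoC y) = (x <= y).
Proof. exact: lecR. Qed.

Lemma conj_RtoC (x : R) : (RtoC x)^* = RtoC x.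
Proof. exact: conjc_real. Qed.

Lemma RtoC_Re (z : C) : 0 <= z -> RtoC (complex.Re z) = z.
Proof. by move=> z0; apply/RRe_real/ger0_real. Qed.

Lemma conjM (x y : C) : (x * y)^* = x^* * y^*. Proof. exact: rmorphM. Qed.
Lemma conjD (x y : C) : (x + y)^* = x^* + y^*. Proof. exact: rmorphD. Qed.
Lemma conjB (x y : C) : (x - y)^* = x^* - y^*. Proof. exact: rmorphB. Qed.
Lemma conj0 : (0 : C)^* = 0. Proof. exact: rmorph0. Qed.
Lemma conj1 : (1 : C)^* = 1. Proof. exact: rmorph1. Qed.

Lemma conj_sum (I : finType) (F : I -> C) : (\sum_i F i)^* = \sum_i (F i)^*.
Proof. exact: rmorph_sum. Qed.

Lemma conj_prod (I : finType) (F : I -> C) : (\prod_i F i)^* = \prod_i (F i)^*.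
Proof. exact: rmorph_prod. Qed.

Definition sqn (z : C) : R := complex.Re (z * z^*).

Lemma RtoC_sqn (z : C) : RtoC (sqn z) = z * z^*.
Proof. by rewrite RtoC_Re // mul_conjC_ge0. Qed.

Lemma sqn_ge0 (z : C) : 0 <= sqn z.
Proof. by rewrite -ler_RtoC RtoC_sqn rmorph0 mul_conjC_ge0. Qed.

Lemma sqnM (z w : C) : sqn (z * w) = sqn z * sqn w.
Proof. by apply: RtoC_inj; rewrite rmorphM /= !RtoC_sqn conjM mulrACA. Qed.

Lemma sqn_RtoC (x : R) : sqn (RtoC x) = x ^+ 2.
Proof. by apply: RtoC_inj; rewrite RtoC_sqn conj_RtoC rmorphXn expr2. Qed.

Lemma sqn_prod (I : finType) (F : I -> C) :
  sqn (\prod_i F i) = \prod_i sqn (F i).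
Proof.
apply: RtoC_inj; rewrite RtoC_sqn conj_prod rmorph_prod /= -big_split /=.
by apply: eq_bigr => i _; rewrite RtoC_sqn.
Qed.

Lemma sqn_conj (z : C) : sqn z^* = sqn z.
Proof. by apply: RtoC_inj; rewrite !RtoC_sqn conjCK mulrC. Qed.

(** Parallelogram law: the two sides differ by [sqn (z - w)]. *)
Lemma sqnD_le (z w : C) : sqn (z + w) <= 2 * (sqn z + sqn w).
Proof.
rewrite -subr_ge0; have := sqn_ge0 (z - w); congr (0 <= _); apply: RtoC_inj.
by rewrite rmorphB rmorphM rmorph_nat rmorphD /= !RtoC_sqn conjB conjD; ring.
Qed.

Definition ip (I : finType) (v w : I -> C) : C := \sum_i (v i)^* * w i.

(** [u j] is the j-th basis vector. The second clause is the resolution of the identity, recorded so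
    that it can be inserted directly into inner products. *)
Definition onb (I : finType) (u : I -> I -> C) : Prop :=
  (forall j j', ip (u j) (u j') = (j == j')%:R) /\
  (forall i i', \sum_j u j i * (u j i')^* = (i == i')%:R).

Lemma conj_ip (I : finType) (v w : I -> C) : (ip v w)^* = ip w v.
Proof.
by rewrite /ip conj_sum; apply: eq_bigr => i _; rewrite conjM conjCK mulrC.
Qed.

Lemma sum_delta (V : pzSemiRingType) (I : finType) (i : I) (F : I -> V) :
  \sum_j (i == j)%:R * F j = F i.
Proof.
rewrite (bigD1 i) //= eqxx mul1r big1 ?addr0 // => j /negbTE.
by rewrite eq_sym => ->; rewrite mul0r.
Qed.

Lemma ip_onb (I : finType) (u : I -> I -> C) (v w : I -> C) : onb u ->
  \sum_j ip v (u j) * ip (u j) w = ip v w.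
Proof.
move=> [_ uc]; under eq_bigr do rewrite /ip big_distrlr /=.
rewrite exchange_big /=; apply: eq_bigr => i _; rewrite exchange_big /=.
rewrite -(sum_delta i w) mulr_sumr; apply: eq_bigr => i' _.
rewrite -uc mulr_suml mulr_sumr; apply: eq_bigr => j _; ring.
Qed.

(** The columns of [m] are orthonormal, so the cross terms cancel when the squares are expanded. *)
Lemma sum_sqn_isometry (J L : finType) (m : J -> L -> C) (c : L -> C) :
  (forall l l', \sum_j (m j l)^* * m j l' = (l == l')%:R) ->
  \sum_j sqn (\sum_l m j l * c l) = \sum_l sqn (c l).
Proof.
move=> mu; apply: RtoC_inj; rewrite !rmorph_sum /=.
under eq_bigr do rewrite RtoC_sqn conj_sum big_distrlr /=.
rewrite exchange_big /=; apply: eq_bigr => l _; rewrite exchange_big /=.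
rewrite RtoC_sqn -(sum_delta l (fun l' => (c l')^*)) mulr_sumr.
apply: eq_bigr => l' _; rewrite eq_sym -mu mulr_suml mulr_sumr.
by apply: eq_bigr => j _; rewrite conjM; ring.
Qed.

Definition qf (I : finType) (A : op R I) (v : I -> C) : C :=
  \sum_i \sum_j (v i)^* * A i j * v j.

(** A spectral decomposition with real eigenvalues, kept as a relation rather than a chosen
    function: products, tensor products and classical-quantum states then come with explicit
    decompositions of their own. *)
Definition eigd (I : finType) (A : op R I) (mu : I -> R) (u : I -> I -> C) :=
  onb u /\ forall i i', A i i' = \sum_j RtoC (mu j) * (u j i * (u j i')^*).

Lemma qf_eigd (I : finType) (A : op R I) mu u v : eigd A mu u ->
  qf A v = RtoC (\sum_j mu j * sqn (ip (u j) v)).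
Proof.
move=> [_ Au]; rewrite /qf rmorph_sum /=.
under eq_bigr do under eq_bigr do rewrite Au mulr_sumr mulr_suml.
under eq_bigr do rewrite exchange_big /=.
rewrite exchange_big /=; apply: eq_bigr => j _.
rewrite rmorphM /= RtoC_sqn conj_ip /ip big_distrlr /= exchange_big mulr_sumr.
apply: eq_bigr => i _; rewrite mulr_sumr; apply: eq_bigr => i' _; ring.
Qed.

Lemma eigd_qf (I : finType) (A : op R I) mu u j : eigd A mu u ->
  qf A (u j) = RtoC (mu j).
Proof.
move=> Au; rewrite (qf_eigd _ Au); congr RtoC.
rewrite (bigD1 j) //= Au.1.1 eqxx sqn_RtoC expr1n mulr1 big1 ?addr0 // => k.
by rewrite Au.1.1 => /negbTE ->; rewrite (sqn_RtoC 0) expr0n mulr0.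
Qed.

Lemma eigd_psd (I : finType) (A : op R I) mu u : eigd A mu u ->
  (forall j, 0 <= mu j) -> psd A.
Proof.
move=> Au mu0 v; rewrite -/(qf A v) (qf_eigd _ Au) (ler_RtoC 0).
by apply: sumr_ge0 => j _; rewrite mulr_ge0 ?sqn_ge0.
Qed.

Lemma eigd_ge0 (I : finType) (A : op R I) mu u j : eigd A mu u -> psd A ->
  0 <= mu j.
Proof. by move=> Au /(_ (u j)); rewrite -/(qf A _) (eigd_qf _ Au) (ler_RtoC 0). Qed.

Lemma trace_mul_eigd (I : finType) (T A : op R I) mu u : eigd A mu u ->
  trace (mulop T A) = \sum_j RtoC (mu j) * qf T (u j).
Proof.
move=> [_ Au]; rewrite /trace /mulop /qf.
under eq_bigr do under eq_bigr do rewrite Au mulr_sumr.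
under eq_bigr do rewrite exchange_big /=.
rewrite exchange_big /=; apply: eq_bigr => j _; rewrite mulr_sumr.
by apply: eq_bigr => i _; rewrite mulr_sumr; apply: eq_bigr => i' _; ring.
Qed.

Lemma trace_eigd (I : finType) (A : op R I) mu u : eigd A mu u ->
  trace A = RtoC (\sum_j mu j).
Proof.
move=> [[uo _] Au]; rewrite /trace; under eq_bigr do rewrite Au.
rewrite exchange_big rmorph_sum /=; apply: eq_bigr => j _.
have := uo j j; rewrite eqxx mulr1n => uj; rewrite -mulr_sumr -[RHS]mulr1 -uj /ip.
by congr (_ * _); apply: eq_bigr => i _; rewrite mulrC.
Qed.

Lemma psd_trace_mul_ge0 (I : finType) (T A : op R I) mu u : psd T ->
  eigd A mu u -> (forall j, 0 <= mu j) -> 0 <= trace (mulop T A).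
Proof.
move=> T0 Au mu0; rewrite (trace_mul_eigd _ Au); apply: sumr_ge0 => j _.
by rewrite mulr_ge0 ?(ler_RtoC 0) // T0.
Qed.

(** Polarization: the quadratic form is real on the vectors x e_i + y e_j. The choices (1,0) and
    (0,1) make the diagonal entries real; (1,1) and (1,i) give two linear relations between [A i j],
    [A j i] and their conjugates, whose sum is the claim. *)
Lemma psd_herm (I : finType) (A : op R I) i j : psd A -> (A j i)^* = A i j.
Proof.
move=> A0; have qfr v : (qf A v)^* = qf A v by apply/CrealP/ger0_real/A0.
pose f (x y : C) k : C := (i == k)%:R * x + (j == k)%:R * y.
have qff x y : qf A (f x y) =
    x^* * x * A i i + x^* * y * A i j + y^* * x * A j i + y^* * y * A j j.
  have H (F : I -> C) : \sum_k F k * f x y k = F i * x + F j * y.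
    rewrite /f; under eq_bigr do rewrite mulrDr.
    rewrite big_split /=; congr (_ + _).
      by rewrite -(sum_delta i (fun k => F k * x)); apply: eq_bigr => k _; ring.
    by rewrite -(sum_delta j (fun k => F k * y)); apply: eq_bigr => k _; ring.
  rewrite /qf; under eq_bigr do rewrite H.
  have G (F : I -> C) : \sum_k (f x y k)^* * F k = x^* * F i + y^* * F j.
    apply: (inv_inj conjCK); rewrite conj_sum conjD !conjM !conjCK.
    under eq_bigr do rewrite conjM conjCK mulrC.
    by rewrite H; ring.
  rewrite (eq_bigr (fun k => (f x y k)^* * (A k i * x + A k j * y))).
    by rewrite G; ring.
  by move=> k _; ring.
have h11 : (A i i)^* = A i i.
  by have := qfr (f 1 0); rewrite qff !conj0 conj1 !(mul0r, mulr0, mul1r, addr0).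
have h22 : (A j j)^* = A j j.
  by have := qfr (f 0 1); rewrite qff !conj0 conj1 !(mul0r, mulr0, mul1r, add0r).
have h1 := qfr (f 1 1); have h2 := qfr (f 1 'i).
move: h1 h2; rewrite !qff !(conjD, conjM) !conj1 !conjCK conjCi h11 h22.
set a := A i j; set b := A j i => h1 h2.
have e1 : b^* + a^* = a + b.
  apply: (addIr (A i i + A j j)).
  transitivity (1 * 1 * A i i + 1 * 1 * a^* + 1 * 1 * b^* + 1 * 1 * A j j).
    by ring.
  by rewrite h1; ring.
have e2 : 'i * (b^* - a^*) = 'i * (a - b).
  apply: (addIr (A i i + (- 'i * 'i) * A j j)).
  transitivity (1 * 1 * A i i + 1 * - 'i * a^* + 'i * 1 * b^* + 'i * - 'i * A j j).
    by ring.
  by rewrite h2; ring.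
have e3 : b^* - a^* = a - b by apply: (mulfI (neq0Ci _)) e2.
have e4 : b^* *+ 2 = a *+ 2.
  by rewrite (_ : b^* *+ 2 = (b^* + a^*) + (b^* - a^*)); [rewrite e1 e3|]; ring.
by apply/eqP; rewrite -(eqr_pMn2r (n := 2)) // e4.
Qed.

End HilbertSpace.

(** * Spectral decompositions and the von Neumann entropy *)

Lemma char_poly_diagonalized (F : comNzRingType) n (V W : 'M[F]_n) (d : 'rV[F]_n) :
  V *m W = 1%:M ->
  char_poly (V *m diag_mx d *m W) = \prod_i ('X - (d 0 i)%:P).
Proof.
move=> VW; pose p (A : 'M[F]_n) := map_mx (@polyC F) A.
have pVW : p V *m p W = 1%:M by rewrite -map_mxM VW map_mx1.
transitivity (char_poly (diag_mx d)); last first.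
  rewrite char_poly_trig ?diag_mx_is_trig //; apply: eq_bigr => i _.
  by rewrite mxE eqxx mulr1n.
rewrite /char_poly /char_poly_mx.
have -> : 'X%:M - p (V *m diag_mx d *m W) = p V *m ('X%:M - p (diag_mx d)) *m p W.
  rewrite mulmxBr mulmxBl /p !map_mxM; congr (_ - _).
  by rewrite scalar_mxC -mulmxA pVW mulmx1.
by rewrite !det_mulmx mulrAC -det_mulmx pVW det1 mul1r.
Qed.

Section Entropy.
Variable R : realType.
Local Notation C := R[i].
Local Notation RtoC := (@RtoC R).
Local Open Scope sesquilinear_scope.

Lemma mxop_herm (I : finType) (A : op R I) : psd A ->
  mxop A \is hermsymmx.
Proof.
move=> A0; apply/is_hermitianmxP; rewrite expr0 scale1r.
by apply/matrixP => i j; rewrite !mxE psd_herm.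
Qed.

Lemma psd_eigd (I : finType) (A : op R I) : psd A -> exists mu u, eigd A mu u.
Proof.
move=> A0; have Ah := mxop_herm A0.
have /orthomx_spectralP AE := hermitian_normalmx Ah.
have dr := hermitian_spectral_diag_real Ah.
have Pu := spectral_unitarymx (mxop A).
move: AE; rewrite invmx_unitary //.
set P := spectralmx _ in Pu *; set d := spectral_diag _ in dr * => AE.
have Pu' : P ^t* *m P = 1%:M by rewrite -invmx_unitary // mulVmx // unitarymx_unit.
have sumE (F : 'I_#|I| -> C) : \sum_(i : I) F (enum_rank i) = \sum_k F k.
  by rewrite [RHS](reindex enum_rank) //; apply: onW_bij; apply: enum_rank_bij.
(* Since A = P^* diag(d) P, the eigenvectors are the conjugated rows of [P]. *)
exists (fun j => complex.Re (d 0 (enum_rank j))).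
exists (fun j i => (P (enum_rank j) (enum_rank i))^*); split; first split.
- move=> j j'; rewrite /ip -(inj_eq enum_rank_inj).
  rewrite (sumE (fun k => (P (enum_rank j) k)^*^* * (P (enum_rank j') k)^*)).
  have /unitarymxP/matrixP/(_ (enum_rank j) (enum_rank j')) := Pu.
  by rewrite !mxE => <-; apply: eq_bigr => k _; rewrite !mxE conjCK.
- move=> i i'; rewrite -(inj_eq enum_rank_inj).
  rewrite (sumE (fun k => (P k (enum_rank i))^* * (P k (enum_rank i'))^*^*)).
  have /matrixP/(_ (enum_rank i) (enum_rank i')) := Pu'.
  by rewrite !mxE => <-; apply: eq_bigr => k _; rewrite !mxE conjCK.
- move=> i i'; have /matrixP/(_ (enum_rank i) (enum_rank i')) := AE.
  rewrite !mxE !enum_rankK => ->.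
  rewrite -(sumE (fun k => ((P ^t* *m diag_mx d) (enum_rank i) k) * P k (enum_rank i'))).
  apply: eq_bigr => j _; rewrite mul_mx_diag !mxE conjCK.
  have -> : RtoC (complex.Re (d 0 (enum_rank j))) = d 0 (enum_rank j).
    by apply: RRe_real; move/mxOverP: dr; apply.
  by ring.
Qed.

(** The entropy may be computed from any spectral decomposition: all of them yield the same
    characteristic polynomial, and its linear factors are unique up to order. *)
Lemma vN_entropy_eigd (I : finType) (A : op R I) mu u : psd A -> eigd A mu u ->
  vN_entropy A = - \sum_j eta2 (mu j).
Proof.
move=> A0 [[uo uc] Au]; rewrite /vN_entropy; congr (- _).
have Ah := mxop_herm A0.
have /orthomx_spectralP AE := hermitian_normalmx Ah.
set d := spectral_diag _ in AE *.
have Pu := spectral_unit (mxop A).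
pose V := \matrix_(i < #|I|, k < #|I|) u (enum_val k) (enum_val i).
pose W := \matrix_(k < #|I|, i < #|I|) (u (enum_val k) (enum_val i))^*.
pose m := \row_(k < #|I|) RtoC (mu (enum_val k)).
have sumE (F : I -> C) : \sum_(k < #|I|) F (enum_val k) = \sum_i F i.
  by rewrite [RHS](reindex (@enum_val I I)) //; apply: onW_bij; apply: enum_val_bij.
have VW : V *m W = 1%:M.
  apply/matrixP => i i'; rewrite !mxE -(inj_eq enum_val_inj) -uc -sumE.
  by apply: eq_bigr => k _; rewrite !mxE.
have AE' : mxop A = V *m diag_mx m *m W.
  apply/matrixP => i i'; rewrite !mxE Au -sumE; apply: eq_bigr => k _.
  by rewrite mul_mx_diag !mxE; ring.
have := char_poly_diagonalized d (mulVmx Pu); rewrite -AE AE'.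
rewrite (char_poly_diagonalized _ VW).
rewrite -(big_map (fun k => m 0 k) xpredT (fun x => 'X - x%:P)).
rewrite -(big_map (fun k => d 0 k) xpredT (fun x => 'X - x%:P)).
move=> /prod_XsubC_eq pe.
rewrite -(big_map (fun k => d 0 k) xpredT (fun x => eta2 (complex.Re x))).
rewrite -(perm_big _ pe) big_map [RHS](reindex (@enum_val I I)) /=.
  by apply: eq_bigr => k _; rewrite mxE.
by apply: onW_bij; apply: enum_val_bij.
Qed.

End Entropy.

(** * Quantum tests and log-likelihood ratios *)

Section Tests.
Variable R : realType.
Local Notation C := R[i].
Local Notation RtoC := (@RtoC R).

Lemma ln_le_sub1 (x : R) : 0 < x -> ln x <= x - 1.
Proof. move=> x0; have := @le_ln1Dx R (x - 1); have -> : 1 + (x - 1) = x by lra.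
by apply; lra. Qed.

(** The inequality ln z <= z - 1 at z = y / x, multiplied by x. Summed over two distributions it
    gives the nonnegativity of relative entropy. *)
Lemma relent_ge_sub (x y : R) : 0 <= x -> 0 <= y -> (0 < x -> 0 < y) ->
  x - y <= x * (ln x - ln y).
Proof.
move=> x0 y0 xy; have [->|xn0] := eqVneq x 0; first by rewrite mul0r; lra.
have xp : 0 < x by rewrite lt_neqAle eq_sym xn0.
have yp := xy xp; have := ln_le_sub1 (divr_gt0 yp xp).
rewrite ln_div ?posrE // => /(ler_wpM2l x0).
have -> : x * (y / x - 1) = y - x by field; lra.
lra.
Qed.

(** Pointwise Markov inequality for the log-likelihood ratio. If x <= g y, the minimum is x, and the
    added y compensates a negative logarithm; otherwise ln g is at most ln x - ln y. *)
Lemma threshold_le (g x y : R) : 1 <= g -> 0 <= x -> 0 <= y -> (0 < x -> 0 < y) ->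
  ln g * x <= ln g * Num.min x (g * y) + x * (ln x - ln y) + y.
Proof.
move=> g1 x0 y0 xy; have L0 := ln_ge0 g1; have K := relent_ge_sub x0 y0 xy.
have [xg|gx] := leP x (g * y); first by lra.
have xp : 0 < x by apply: le_lt_trans gx; rewrite mulr_ge0 //; lra.
have yp := xy xp; have gp : 0 < g by lra.
have : ln (g * y) <= ln x by rewrite ler_ln ?posrE ?mulr_gt0 // ltW.
rewrite lnM ?posrE // => H.
have : ln g * x <= x * (ln x - ln y) by rewrite [leLHS]mulrC ler_wpM2l //; lra.
have : 0 <= ln g * (g * y) by rewrite !mulr_ge0 //; lra.
lra.
Qed.

Lemma eigd_idop_sub (I : finType) (T : op R I) tau t : eigd T tau t ->
  eigd (subop (@idop R I) T) (fun l => 1 - tau l) t.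
Proof.
move=> [tb Tt]; split=> // i i'; rewrite /subop /idop Tt -tb.2 -sumrB.
by apply: eq_bigr => l _; rewrite rmorphB rmorph1 mulrBl mul1r.
Qed.

Definition overlap (I : finType) (a b : I -> I -> C) i j : R := sqn (ip (a i) (b j)).

Lemma overlap_ge0 (I : finType) (a b : I -> I -> C) i j : 0 <= overlap a b i j.
Proof. exact: sqn_ge0. Qed.

Lemma sum_sqn_ip (I : finType) (b : I -> I -> C) v : onb b ->
  RtoC (\sum_j sqn (ip (b j) v)) = ip v v.
Proof.
move=> bo; rewrite -(ip_onb v v bo) rmorph_sum; apply: eq_bigr => j _.
by rewrite /= RtoC_sqn conj_ip mulrC.
Qed.

Lemma overlapC (I : finType) (a b : I -> I -> C) i j :
  overlap a b i j = overlap b a j i.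
Proof. by rewrite /overlap -conj_ip sqn_conj. Qed.

Lemma overlap_suml (I : finType) (a b : I -> I -> C) j : onb a -> onb b ->
  \sum_i overlap a b i j = 1.
Proof.
move=> ao bo; apply: RtoC_inj; rewrite (sum_sqn_ip (b j) ao) bo.1 eqxx.
by rewrite rmorph1.
Qed.

Lemma overlap_sumr (I : finType) (a b : I -> I -> C) i : onb a -> onb b ->
  \sum_j overlap a b i j = 1.
Proof. by move=> ao bo; under eq_bigr do rewrite overlapC; apply: overlap_suml. Qed.

(* The Nussbaum-Szkola reduction of a quantum test to a classical one: with
   z = <a_i|b_j> = <a_i|1-T|b_j> + <a_i|T|b_j>, at least half of |z|^2 is
   carried by the two summands, and 0 <= T <= 1 gives T^2 <= T. *)
Lemma nussbaum_szkola (I : finType) (T s w : op R I) (lam mu : I -> R) a b (g : R) :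
  psd T -> psd (subop (@idop R I) T) -> eigd s lam a -> eigd w mu b ->
  (forall i, 0 <= lam i) -> (forall j, 0 <= mu j) -> 0 <= g ->
  RtoC (2^-1 * \sum_i \sum_j Num.min (lam i) (g * mu j) * overlap a b i j) <=
  trace (mulop (subop (@idop R I) T) s) + RtoC g * trace (mulop T w).
Proof.
move=> T0 T1 sa wb lam0 mu0 g0; have [tau [t Tt]] := psd_eigd T0.
have Tt' := eigd_idop_sub Tt; have tau0 l := eigd_ge0 l Tt T0.
have tau1 l := eigd_ge0 l Tt' T1.
have [ao bo to] : [/\ onb a, onb b & onb t] by case: sa wb Tt => ? _ [? _] [? _].
(* [y] is <a_i|T|b_j> and [y'] is <a_i|1-T|b_j>, expanded in the eigenbasis [t] of T. In each
   product the first factor is the isometry to be removed, by summing over i for [y] and over j for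
   [y']. *)
pose y i j := \sum_l ip (a i) (t l) * (RtoC (tau l) * ip (t l) (b j)).
pose y' i j := \sum_l ip (t l) (b j) * (RtoC (1 - tau l) * ip (a i) (t l)).
have zE i j : ip (a i) (b j) = y i j + y' i j.
  rewrite -(ip_onb _ _ to) -big_split; apply: eq_bigr => l _ /=.
  by rewrite rmorphB rmorph1; ring.
have sq_le (x r : R) : 0 <= x -> x <= 1 -> 0 <= r -> x ^+ 2 * r <= x * r.
  by move=> x0 x1 r0; rewrite ler_wpM2r // expr2 ler_piMr.
have yE j : \sum_i sqn (y i j) <= \sum_l tau l * sqn (ip (t l) (b j)).
  rewrite sum_sqn_isometry; last first.
    move=> l l'; rewrite -to.1 -(ip_onb _ _ ao).
    by apply: eq_bigr => i _; rewrite conj_ip.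
  apply: ler_sum => l _; rewrite sqnM sqn_RtoC sq_le ?sqn_ge0 //.
  by have := tau1 l; lra.
have y'E i : \sum_j sqn (y' i j) <= \sum_l (1 - tau l) * sqn (ip (t l) (a i)).
  rewrite sum_sqn_isometry; last first.
    move=> l l'; rewrite eq_sym -to.1 -(ip_onb _ _ bo).
    by apply: eq_bigr => j _; rewrite conj_ip mulrC.
  apply: ler_sum => l _; rewrite -conj_ip sqnM sqn_conj sqn_RtoC sq_le ?sqn_ge0 //.
  by have := tau0 l; lra.
rewrite (trace_mul_eigd _ sa) (trace_mul_eigd _ wb).
have qfE A nu (v : I -> I -> C) (c : I -> R) : eigd A nu t ->
    \sum_j RtoC (c j) * qf A (v j) =
    RtoC (\sum_j c j * \sum_l nu l * sqn (ip (t l) (v j))).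
  move=> At; rewrite rmorph_sum; apply: eq_bigr => j _.
  by rewrite (qf_eigd _ At) rmorphM.
rewrite (qfE _ _ _ _ Tt') (qfE _ _ _ _ Tt) -rmorphM -rmorphD /= ler_RtoC.
(* [S1] is the sum of lam_i |(1-T) a_i|^2 and [S2] that of g mu_j |T b_j|^2, so they are bounded by
   the first and the second trace respectively. *)
pose S1 := \sum_i lam i * \sum_j sqn (y' i j).
pose S2 := \sum_j g * mu j * \sum_i sqn (y i j).
apply: (@le_trans _ _ (S1 + S2)); last first.
  apply: lerD; first by apply: ler_sum => i _; rewrite ler_wpM2l.
  by rewrite mulr_sumr; apply: ler_sum => j _; rewrite mulrA ler_wpM2l // mulr_ge0.
have -> : S1 + S2 = \sum_i \sum_j (lam i * sqn (y' i j) + g * mu j * sqn (y i j)).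
  have -> : S2 = \sum_i \sum_j g * mu j * sqn (y i j).
    by rewrite exchange_big; apply: eq_bigr => j _; rewrite mulr_sumr.
  by rewrite -big_split; apply: eq_bigr => i _ /=; rewrite big_split mulr_sumr.
rewrite mulr_sumr; apply: ler_sum => i _; rewrite mulr_sumr; apply: ler_sum => j _.
have m0 : 0 <= Num.min (lam i) (g * mu j) by rewrite le_min lam0 mulr_ge0.
apply: (@le_trans _ _ (Num.min (lam i) (g * mu j) * (sqn (y' i j) + sqn (y i j)))).
  rewrite mulrCA ler_wpM2l // /overlap zE.
  by have := sqnD_le (y i j) (y' i j); lra.
by rewrite mulrDr lerD // ler_wpM2r ?sqn_ge0 // ge_min lexx ?orbT.
Qed.

(** The relative entropy in nats, as the mean log-likelihood ratio of the Nussbaum-Szkola pair; the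
    overlaps cancel in the ratio P_ij / Q_ij. *)
Definition llr (I : finType) (lam mu : I -> R) (a b : I -> I -> C) : R :=
  \sum_i \sum_j lam i * overlap a b i j * (ln (lam i) - ln (mu j)).

(** Here [e] and [t] are the two error probabilities of the test. The bound is [threshold_le]
    weighted by the overlaps and summed: the left side totals ln g, the last term totals 1, and the
    sum of the minima is at most twice e + g t by [nussbaum_szkola]. *)
Lemma test_llr (I : finType) (T s w : op R I) (lam mu : I -> R) a b (g e t : R) :
  psd T -> psd (subop (@idop R I) T) -> eigd s lam a -> eigd w mu b ->
  (forall i, 0 <= lam i) -> (forall j, 0 <= mu j) ->
  \sum_i lam i = 1 -> \sum_j mu j = 1 ->
  (forall i j, 0 < lam i -> 0 < overlap a b i j -> 0 < mu j) -> 1 <= g ->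
  trace (mulop (subop (@idop R I) T) s) = RtoC e -> trace (mulop T w) = RtoC t ->
  ln g <= 2 * ln g * (e + g * t) + llr lam mu a b + 1.
Proof.
move=> T0 T1 sa wb lam0 mu0 lam1 mu1 ac g1 eE tE.
have g0 : 0 <= g by lra.
have := nussbaum_szkola T0 T1 sa wb lam0 mu0 g0.
rewrite eE tE -rmorphM -rmorphD ler_RtoC.
set S := \sum_i _ => SE; have L0 := ln_ge0 g1.
have thr x y := @threshold_le g x y g1; move: L0 thr SE; set L := ln g => L0 thr SE.
suff : L <= L * S + llr lam mu a b + 1 by have := ler_wpM2l L0 SE; lra.
have EL : \sum_i \sum_j L * lam i * overlap a b i j = L.
  under eq_bigr do rewrite -mulr_sumr (overlap_sumr _ sa.1 wb.1) mulr1.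
  by rewrite -mulr_sumr lam1 mulr1.
have E1 : \sum_i \sum_j mu j * overlap a b i j = 1.
  rewrite exchange_big /= -mu1; apply: eq_bigr => j _.
  by rewrite -mulr_sumr (overlap_suml _ sa.1 wb.1) mulr1.
rewrite -[leLHS]EL -[X in _ + X]E1 /S /llr mulr_sumr -!big_split.
apply: ler_sum => i _ /=; rewrite mulr_sumr -!big_split; apply: ler_sum => j _ /=.
(* Pairs of orthogonal eigenvectors carry no weight; [ac] covers the others. *)
have [->|Wn0] := eqVneq (overlap a b i j) 0; first by rewrite !(mulr0, mul0r) !addr0.
have W0 := overlap_ge0 a b i j.
have Wp : 0 < overlap a b i j by rewrite lt_neqAle eq_sym Wn0.
have := ler_wpM2r W0 (thr _ _ (lam0 i) (mu0 j) (fun h => ac i j h Wp)).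
by congr (is_true (_ <= _)); ring.
Qed.

End Tests.

(** * Product states and mixtures *)

Section Products.
Variable R : realType.
Local Notation C := R[i].
Local Notation RtoC := (@RtoC R).

Lemma ln_prod (K : finType) (x : K -> R) : (forall k, 0 < x k) ->
  ln (\prod_k x k) = \sum_k ln (x k).
Proof.
move=> x0; have [//] : ln (\prod_k x k) = \sum_k ln (x k) /\ 0 < \prod_k x k.
elim/big_rec2: _ => [|k y z _ [<- z0]]; first by rewrite ln1.
by rewrite lnM ?posrE ?mulr_gt0.
Qed.

Definition prodop (K J : finType) (A : K -> op R J) : op R {ffun K -> J} :=
  fun f g => \prod_k A k (f k) (g k).

Definition prodbasis (K J : finType) (u : K -> J -> J -> C)
    (f g : {ffun K -> J}) : C := \prod_k u k (f k) (g k).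

Lemma ip_prod (K J : finType) (v w : K -> J -> C) :
  ip (fun g : {ffun K -> J} => \prod_k v k (g k)) (fun g => \prod_k w k (g k)) =
  \prod_k ip (v k) (w k).
Proof.
rewrite /ip bigA_distr_bigA; apply: eq_bigr => g _.
by rewrite conj_prod -big_split.
Qed.

Lemma prod_delta (K J : finType) (f g : {ffun K -> J}) :
  \prod_k (f k == g k)%:R = (f == g)%:R :> C.
Proof.
have [->|fg] := eqVneq f g; first by rewrite big1 // => k _; rewrite eqxx.
have [k fk] : exists k, f k != g k.
  apply/existsP; apply: contraNT fg => /existsPn h.
  by apply/eqP/ffunP => k; apply/eqP/negPn/h.
by rewrite (bigD1 k) //= (negbTE fk) mul0r.
Qed.

Lemma eigd_prod (K J : finType) (A : K -> op R J) mu u :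
  (forall k, eigd (A k) (mu k) (u k)) ->
  eigd (prodop A) (fun f : {ffun K -> J} => \prod_k mu k (f k)) (prodbasis u).
Proof.
move=> Au; split; first split.
- move=> f f'; rewrite (ip_prod (fun k => u k (f k)) (fun k => u k (f' k))) -prod_delta.
  by apply: eq_bigr => k _; rewrite (Au k).1.1.
- move=> g g'; rewrite -prod_delta.
  rewrite (eq_bigr (fun k => \sum_j u k j (g k) * (u k j (g' k))^*)).
    rewrite bigA_distr_bigA; apply: eq_bigr => f _.
    by rewrite /prodbasis conj_prod -big_split.
  by move=> k _; rewrite (Au k).1.2.
move=> g g'; rewrite /prodop.
rewrite (eq_bigr (fun k => \sum_j RtoC (mu k j) * (u k j (g k) * (u k j (g' k))^*))).
  rewrite bigA_distr_bigA; apply: eq_bigr => f _.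
  by rewrite /prodbasis conj_prod rmorph_prod -!big_split.
by move=> k _; rewrite (Au k).2.
Qed.

Lemma overlap_prod (K J : finType) (a b : K -> J -> J -> C) (f g : {ffun K -> J}) :
  overlap (prodbasis a) (prodbasis b) f g = \prod_k overlap (a k) (b k) (f k) (g k).
Proof.
by rewrite /overlap (ip_prod (fun k => a k (f k)) (fun k => b k (g k))) sqn_prod.
Qed.

Lemma sum_prod_pair (K J : finType) (F : K -> J -> J -> R) :
  \sum_(f : {ffun K -> J}) \sum_(g : {ffun K -> J}) \prod_k F k (f k) (g k) =
  \prod_k \sum_i \sum_j F k i j.
Proof.
rewrite bigA_distr_bigA; apply: eq_bigr => f _.
by rewrite bigA_distr_bigA.
Qed.

(** Additivity of relative entropy over tensor products: the logarithm of the product splits into a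
    sum over k, and in the k-th summand all other factors are distributions summing to 1. *)
Lemma llr_prod (K J : finType) (lam mu : K -> J -> R) a b :
  (forall k, onb (a k)) -> (forall k, onb (b k)) ->
  (forall k i, 0 <= lam k i) -> (forall k, \sum_i lam k i = 1) ->
  (forall k i j, 0 < lam k i -> 0 < overlap (a k) (b k) i j -> 0 < mu k j) ->
  llr (fun f : {ffun K -> J} => \prod_k lam k (f k)) (fun g => \prod_k mu k (g k))
      (prodbasis a) (prodbasis b) =
  \sum_k llr (lam k) (mu k) (a k) (b k).
Proof.
move=> ao bo lam0 lam1 ac.
pose P k i j := lam k i * overlap (a k) (b k) i j.
pose h k i j := ln (lam k i) - ln (mu k j).
have P1 k : \sum_i \sum_j P k i j = 1.
  rewrite -[RHS](lam1 k); apply: eq_bigr => i _.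
  by rewrite -mulr_sumr (overlap_sumr _ (ao k) (bo k)) mulr1.
(* The k-th logarithm is placed inside the product over l, so that the sum over all pairs of words
   factorizes. *)
have termE (f g : {ffun K -> J}) : (\prod_k lam k (f k)) *
    overlap (prodbasis a) (prodbasis b) f g *
    (ln (\prod_k lam k (f k)) - ln (\prod_k mu k (g k))) =
    \sum_k \prod_l (P l (f l) (g l) * (if l == k then h k (f l) (g l) else 1)).
  rewrite overlap_prod -big_split /= -/(P _ _ _).
  have -> : \sum_k \prod_l (P l (f l) (g l) * (if l == k then h k (f l) (g l) else 1))
      = (\prod_l P l (f l) (g l)) * \sum_k h k (f k) (g k).
    rewrite mulr_sumr; apply: eq_bigr => k _; rewrite big_split /=; congr (_ * _).
    by rewrite (bigD1 k) //= eqxx big1 ?mulr1 // => l /negbTE ->.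
  (* If some letter pair has probability zero, both sides vanish; otherwise every factor is positive
     and the logarithms of the products split. *)
  have [/eqP/prodf_eq0[k _ /eqP Pk]|/prodf_neq0 Pn0] :=
      eqVneq (\prod_l P l (f l) (g l)) 0.
    by rewrite (bigD1 k) //= -/(P k _ _) Pk !mul0r.
  have pos k : 0 < lam k (f k) /\ 0 < overlap (a k) (b k) (f k) (g k).
    have := Pn0 k isT; rewrite mulf_eq0 negb_or => /andP[l0 o0].
    by rewrite !lt_neqAle ![0 == _]eq_sym l0 o0 lam0 overlap_ge0.
  rewrite !ln_prod; last by move=> k; case: (pos k).
    by rewrite -sumrB.
  by move=> k; case: (pos k) => ? ?; apply: ac; eassumption.
rewrite /llr.
transitivity (\sum_(f : {ffun K -> J}) \sum_(g : {ffun K -> J})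
    \sum_k \prod_l (P l (f l) (g l) * (if l == k then h k (f l) (g l) else 1))).
  by apply: eq_bigr => f _; apply: eq_bigr => g _; apply: termE.
under eq_bigr do rewrite exchange_big /=.
rewrite exchange_big /=; apply: eq_bigr => k _.
rewrite (sum_prod_pair (fun l i j => P l i j * (if l == k then h k i j else 1))).
rewrite (bigD1 k) //= eqxx [X in _ * X]big1 ?mulr1 // => l /negbTE ->.
by rewrite -[RHS](P1 l); apply: eq_bigr => i _; apply: eq_bigr => j _; rewrite mulr1.
Qed.

Definition mixop (X J : finType) (p : X -> R) (tau : X -> op R J) : op R J :=
  fun i j => \sum_x RtoC (p x) * tau x i j.

Lemma qf_mix (X J : finType) (p : X -> R) (tau : X -> op R J) v :
  qf (mixop p tau) v = \sum_x RtoC (p x) * qf (tau x) v.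
Proof.
rewrite /qf /mixop; under eq_bigr do under eq_bigr do rewrite mulr_sumr mulr_suml.
under eq_bigr do rewrite exchange_big /=.
rewrite exchange_big /=; apply: eq_bigr => x _; rewrite mulr_sumr.
by apply: eq_bigr => i _; rewrite mulr_sumr; apply: eq_bigr => j _; ring.
Qed.

Lemma density_mix (X J : finType) (p : X -> R) (tau : X -> op R J) :
  pmf p -> (forall x, density (tau x)) -> density (mixop p tau).
Proof.
move=> [p0 p1] td; split.
  move=> v; rewrite -/(qf _ v) qf_mix; apply: sumr_ge0 => x _.
  by rewrite mulr_ge0 ?(ler_RtoC 0) //; apply: (td x).1.
rewrite /trace /mixop exchange_big /=.
under eq_bigr do rewrite -mulr_sumr -/(trace _) (td _).2 mulr1.
by rewrite -rmorph_sum /= p1 rmorph1.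
Qed.

(** [ln] is 0 at nonpositive arguments, which absorbs the case distinction. *)
Lemma eta2E (x : R) : eta2 x = x * (ln x / ln 2).
Proof. by rewrite /eta2; case: ltP => // x0; rewrite ln0 // mul0r mulr0. Qed.

Lemma ln2_gt0 : 0 < ln 2 :> R.
Proof. by apply: ln_gt0; rewrite ltr1n. Qed.

Lemma ln2_entropy (J : finType) (A : op R J) mu u : psd A -> eigd A mu u ->
  ln 2 * vN_entropy A = - \sum_j mu j * ln (mu j).
Proof.
move=> A0 Au; rewrite (vN_entropy_eigd A0 Au) mulrN mulr_sumr; congr (- _).
apply: eq_bigr => j _; rewrite eta2E; field.
by rewrite gt_eqF // ln2_gt0.
Qed.

(** The Holevo quantity of the ensemble, in bits. *)
Definition chi (X J : finType) (p : X -> R) (tau : X -> op R J) : R :=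
  vN_entropy (mixop p tau) - \sum_x p x * vN_entropy (tau x).

(** The mean relative entropy to the average state is the Holevo quantity, because mu_j =
    <b_j|w|b_j> is the average over x of <b_j|tau_x|b_j>. The factor [ln 2] converts bits to
    nats. *)
Lemma llr_mix (X J : finType) (p : X -> R) (tau : X -> op R J) lam a mu b :
  pmf p -> (forall x, density (tau x)) ->
  (forall x, eigd (tau x) (lam x) (a x)) -> eigd (mixop p tau) mu b ->
  \sum_x p x * llr (lam x) mu (a x) b = ln 2 * chi p tau.
Proof.
move=> pp td ta wb; have [w0 _] := density_mix pp td.
rewrite /chi mulrBr (ln2_entropy w0 wb) mulr_sumr.
have qfb x j : qf (tau x) (b j) = RtoC (\sum_i lam x i * overlap (a x) b i j).
  by rewrite (qf_eigd _ (ta x)).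
have muE j : mu j = \sum_x p x * \sum_i lam x i * overlap (a x) b i j.
  apply: RtoC_inj; rewrite -(eigd_qf j wb) qf_mix rmorph_sum.
  by apply: eq_bigr => x _; rewrite qfb -rmorphM.
have llrE x : llr (lam x) mu (a x) b =
    - (ln 2 * vN_entropy (tau x)) -
    \sum_j (\sum_i lam x i * overlap (a x) b i j) * ln (mu j).
  rewrite (ln2_entropy (td x).1 (ta x)) opprK /llr.
  have -> : \sum_j (\sum_i lam x i * overlap (a x) b i j) * ln (mu j) =
      \sum_i \sum_j lam x i * overlap (a x) b i j * ln (mu j).
    by rewrite exchange_big; apply: eq_bigr => j _; rewrite mulr_suml.
  rewrite -sumrB; apply: eq_bigr => i _.
  rewrite (eq_bigr (fun j => lam x i * ln (lam x i) * overlap (a x) b i j -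
      lam x i * overlap (a x) b i j * ln (mu j))); last by move=> j _; ring.
  by rewrite sumrB -mulr_sumr (overlap_sumr _ (ta x).1 wb.1) mulr1.
under eq_bigr do rewrite llrE mulrBr mulrN.
rewrite sumrB sumrN addrC; congr (- _ - _).
  transitivity (\sum_j \sum_x p x * (\sum_i lam x i * overlap (a x) b i j) * ln (mu j)).
    rewrite exchange_big; apply: eq_bigr => x _; rewrite mulr_sumr.
    by apply: eq_bigr => j _; rewrite mulrA.
  by apply: eq_bigr => j _; rewrite {2}muE mulr_suml.
by apply: eq_bigr => x _; ring.
Qed.

(** The support condition required by [test_llr]: the average dominates p_x tau_x, so mu_j >= p_x
    lam_i |<a_i|b_j>|^2. *)
Lemma mix_support (X J : finType) (p : X -> R) (tau : X -> op R J) x lam a mu b i j :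
  (forall y, 0 <= p y) -> 0 < p x -> (forall y, psd (tau y)) ->
  eigd (tau x) lam a -> eigd (mixop p tau) mu b ->
  0 < lam i -> 0 < overlap a b i j -> 0 < mu j.
Proof.
move=> p0 px t0 tx wb li oij.
have lam0 i' := eigd_ge0 i' tx (t0 x).
have q0 y : 0 <= qf (tau y) (b j) by apply: t0.
have : RtoC 0 < RtoC (mu j); last by rewrite /RtoC ltcR.
rewrite -(eigd_qf j wb) qf_mix rmorph0 (bigD1 x) //=.
apply: ltr_wpDr.
  by apply: sumr_ge0 => y _; rewrite mulr_ge0 ?(ler_RtoC 0).
rewrite (qf_eigd _ tx) -rmorphM /= (_ : 0 = RtoC 0) ?rmorph0 // /RtoC ltcR.
rewrite mulr_gt0 // (bigD1 i) //= ltr_wpDr ?mulr_gt0 //.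
by apply: sumr_ge0 => i' _; rewrite mulr_ge0 ?overlap_ge0.
Qed.

End Products.

(** * The one-shot converse *)

Section Converse.
Variable R : realType.
Local Notation C := R[i].
Local Notation RtoC := (@RtoC R).

Lemma psd_eigdP (I : finType) (A : op R I) : psd A ->
  exists r : (I -> R) * (I -> I -> C), eigd A r.1 r.2.
Proof. by move=> /psd_eigd[mu [u Au]]; exists (mu, u). Qed.

Lemma density_pmf (I : finType) (A : op R I) mu u : density A -> eigd A mu u ->
  pmf mu.
Proof.
move=> [A0 A1] Au; split=> [j|]; first exact: eigd_ge0 Au A0.
by apply: RtoC_inj; rewrite -(trace_eigd Au) A1 rmorph1.
Qed.

(** The complement of one POVM element is the sum of the others. *)
Lemma psd_idop_sub (M I : finType) (L : M -> op R I) m :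
  povm L -> psd (subop (@idop R I) (L m)).
Proof.
move=> [L0 L1] v; rewrite -/(qf _ v).
suff -> : qf (subop (@idop R I) (L m)) v = \sum_(m' | m' != m) qf (L m') v.
  by apply: sumr_ge0 => m' _; apply: L0.
rewrite /qf [RHS]exchange_big; apply: eq_bigr => i _; rewrite [RHS]exchange_big.
apply: eq_bigr => j _; rewrite -mulr_suml -mulr_sumr; congr (_ * _ * _).
by rewrite /subop -L1 (bigD1 m) //= addrC addrK.
Qed.

Lemma sum_trace_mulop (M I : finType) (L : M -> op R I) (A : op R I) :
  povm L -> \sum_m trace (mulop (L m) A) = trace A.
Proof.
move=> [_ L1]; rewrite exchange_big /=; apply: eq_bigr => i _.
rewrite exchange_big /= -(sum_delta i (fun k => A k i)).
by apply: eq_bigr => k _; rewrite -mulr_suml L1.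
Qed.

(** [a] is the message to be decoded, [y] the remaining randomness, [k] the channel use. [test_llr]
    compares each codeword state with the product over k of the averages over [a], and the resulting
    inequalities are summed over all [a] and [y]. *)
Lemma converse_chi_ge1 (A Y J K : finType) (tau : A -> Y -> K -> op R J)
    (T : A -> op R {ffun K -> J}) (eps : R) :
  (forall a y k, density (tau a y k)) -> povm T ->
  (0 < #|A|)%N -> (0 < #|Y|)%N -> 1 <= eps * #|A|%:R ->
  \sum_a \sum_y trace (mulop (subop (@idop R _) (T a)) (prodop (tau a y)))
    <= RtoC (eps * (#|A| * #|Y|)%:R) ->
  ln (eps * #|A|%:R) * (1 - 4 * eps) <= 1 + ln 2 *
    \sum_k \sum_y #|Y|%:R^-1 * chi (fun=> #|A|%:R^-1) (fun a => tau a y k).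
Proof.
move=> td Tp A0 Y0 g1 err.
have A0' : 0 < #|A|%:R :> R by rewrite ltr0n.
have Y0' : 0 < #|Y|%:R :> R by rewrite ltr0n.
pose unif (_ : A) : R := #|A|%:R^-1.
have unifP : pmf unif.
  split=> [a|]; first by rewrite invr_ge0 ler0n.
  by rewrite sumr_const -[LHS]mulr_natl mulfV // gt_eqF.
pose om y k := mixop unif (fun a => tau a y k).
have omd y k : density (om y k) by apply: density_mix.
have [f fP] := boolp.choice (fun t : A * Y * K => psd_eigdP (td t.1.1 t.1.2 t.2).1).
have [h hP] := boolp.choice (fun t : Y * K => psd_eigdP (omd t.1 t.2).1).
pose lam a y k := (f (a, y, k)).1; pose u a y k := (f (a, y, k)).2.
pose mu y k := (h (y, k)).1; pose b y k := (h (y, k)).2.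
have lamE a y k : eigd (tau a y k) (lam a y k) (u a y k) := fP (a, y, k).
have muE y k : eigd (om y k) (mu y k) (b y k) := hP (y, k).
have lamP a y k := density_pmf (td a y k) (lamE a y k).
have muP y k := density_pmf (omd y k) (muE y k).
have prod_pmf (nu : K -> J -> R) : (forall k, pmf (nu k)) ->
    pmf (fun g : {ffun K -> J} => \prod_k nu k (g k)).
  move=> nuP; split=> [g|]; first by apply: prodr_ge0 => k _; apply: (nuP k).1.
  by rewrite -bigA_distr_bigA big1 // => k _; apply: (nuP k).2.
have LE a y := eigd_prod (lamE a y); have ME y := eigd_prod (muE y).
have Lp a y := prod_pmf _ (lamP a y); have Mp y := prod_pmf _ (muP y).
pose e a y := complex.Re (trace (mulop (subop (@idop R _) (T a)) (prodop (tau a y)))).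
pose t a y := complex.Re (trace (mulop (T a) (prodop (om y)))).
have eE a y : trace (mulop (subop (@idop R _) (T a)) (prodop (tau a y))) = RtoC (e a y).
  rewrite RtoC_Re // (psd_trace_mul_ge0 _ (LE a y)) //; last exact: (Lp a y).1.
  exact: psd_idop_sub.
have tE a y : trace (mulop (T a) (prodop (om y))) = RtoC (t a y).
  rewrite RtoC_Re // (psd_trace_mul_ge0 _ (ME y)) //; last exact: (Mp y).1.
  exact: Tp.1.
pose D a y := \sum_k llr (lam a y k) (mu y k) (u a y k) (b y k).
(* The threshold balances the errors: the reference state does not depend on [a], so the second
   error averages to 1 / #|A|, and [g] times this is [eps]. *)
set g := eps * _ in g1 *; set L := ln g.
have bound a y : L <= 2 * L * (e a y + g * t a y) + D a y + 1.
  have ac k i j : 0 < lam a y k i -> 0 < overlap (u a y k) (b y k) i j -> 0 < mu y k j.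
    apply: (mix_support (p := unif) (tau := fun a => tau a y k) (x := a)).
    - exact: unifP.1.
    - by rewrite invr_gt0.
    - by move=> ?; apply: (td _ _ _).1.
    - exact: lamE.
    - exact: muE.
  have DE := llr_prod (fun k => (lamE a y k).1) (fun k => (muE y k).1)
    (fun k => (lamP a y k).1) (fun k => (lamP a y k).2) ac.
  rewrite /D -DE.
  apply: (test_llr (Tp.1 a) (psd_idop_sub a Tp) (LE a y) (ME y)) => //.
  - exact: (Lp a y).1.
  - exact: (Mp y).1.
  - exact: (Lp a y).2.
  - exact: (Mp y).2.
  move=> i j /= li; rewrite overlap_prod => oij.
  apply: prodr_gt0 => k _; apply: (ac k (i k)).
    rewrite lt_neqAle (lamP a y k).1 eq_sym andbT.
    by apply: contraTneq li => li; rewrite (bigD1 k) //= li mul0r ltxx.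
  rewrite lt_neqAle overlap_ge0 eq_sym andbT.
  by apply: contraTneq oij => oij; rewrite (bigD1 k) //= oij mul0r ltxx.
have esum : \sum_a \sum_y e a y <= eps * (#|A| * #|Y|)%:R.
  rewrite -ler_RtoC; apply: le_trans err; rewrite rmorph_sum /=.
  by apply: ler_sum => a _; rewrite rmorph_sum /=; apply: ler_sum => y _; rewrite eE.
have tsum : \sum_a \sum_y t a y = #|Y|%:R.
  rewrite exchange_big /= (eq_bigr (fun=> 1)) ?sumr_const // => y _.
  apply: RtoC_inj; rewrite rmorph_sum /= rmorph1.
  under eq_bigr do rewrite -tE.
  by rewrite (sum_trace_mulop _ Tp) (trace_eigd (ME y)) (Mp y).2 rmorph1.
have Dsum : \sum_a \sum_y D a y = (#|A| * #|Y|)%:R * (ln 2 *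
    \sum_k \sum_y #|Y|%:R^-1 * chi (fun=> #|A|%:R^-1) (fun a => tau a y k)).
  rewrite exchange_big /= mulrA [RHS]mulr_sumr.
  under eq_bigr do rewrite exchange_big /=.
  rewrite exchange_big /=; apply: eq_bigr => k _; rewrite mulr_sumr.
  apply: eq_bigr => y _.
  have := llr_mix unifP (fun a => td a y k) (fun a => lamE a y k) (muE y k).
  rewrite -mulr_sumr => /(f_equal (fun z => #|A|%:R * z)).
  rewrite mulrA mulfV ?gt_eqF // mul1r => ->.
  by rewrite -/unif natrM; field; rewrite gt_eqF.
have N0 : 0 < (#|A| * #|Y|)%:R :> R by rewrite natrM mulr_gt0.
have sum1 (c : R) : \sum_(a : A) \sum_(y : Y) c = (#|A| * #|Y|)%:R * c.
  by rewrite !sumr_const -mulrnA mulr_natl mulnC.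
rewrite -(ler_pM2l N0).
have : \sum_(a : A) \sum_(y : Y) L <=
    \sum_a \sum_y (2 * L * (e a y + g * t a y) + D a y + 1).
  by apply: ler_sum => a _; apply: ler_sum => y _.
have -> : \sum_a \sum_y (2 * L * (e a y + g * t a y) + D a y + 1) =
    2 * L * (\sum_a \sum_y e a y + g * \sum_a \sum_y t a y) +
    \sum_a \sum_y D a y + (#|A| * #|Y|)%:R * 1.
  rewrite -sum1 mulr_sumr -big_split mulr_sumr -!big_split.
  apply: eq_bigr => a _ /=; rewrite mulr_sumr -big_split mulr_sumr -!big_split.
  by apply: eq_bigr => y _.
rewrite sum1 Dsum tsum.
have L0 : 0 <= L by apply: ln_ge0.
have := ler_wpM2l L0 esum.
(* Both kinds of error now contribute at most [eps] per pair; with the factor 2 of [test_llr] this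
   gives 4 * [eps]. *)
have -> : g * #|Y|%:R = eps * (#|A| * #|Y|)%:R by rewrite /g natrM mulrA.
set X := ln 2 * _; set N := (_ * _)%:R; set E := \sum_a _.
rewrite !(mulrDr, mulrBr, mulrDl, mulr1) => H1 H2; lra.
Qed.

End Converse.

(** * Bipartite systems *)

Section Bipartite.
Variable R : realType.
Local Notation C := R[i].
Local Notation RtoC := (@RtoC R).

Lemma llr_ge0 (I : finType) (lam mu : I -> R) a b : onb a -> onb b ->
  pmf lam -> pmf mu ->
  (forall i j, 0 < lam i -> 0 < overlap a b i j -> 0 < mu j) ->
  0 <= llr lam mu a b.
Proof.
move=> ao bo [lam0 lam1] [mu0 mu1] ac.
(* Zero is written as the total of P_ij - Q_ij, which reduces the claim to [relent_ge_sub] term by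
   term. *)
have <- : \sum_i \sum_j (lam i - mu j) * overlap a b i j = 0.
  under eq_bigr do under eq_bigr do rewrite mulrBl.
  under eq_bigr do rewrite sumrB -mulr_sumr (overlap_sumr _ ao bo) mulr1.
  rewrite sumrB lam1 exchange_big /=.
  under eq_bigr do rewrite -mulr_sumr (overlap_suml _ ao bo) mulr1.
  by rewrite mu1 subrr.
apply: ler_sum => i _; apply: ler_sum => j _.
have [->|Wn0] := eqVneq (overlap a b i j) 0; first by rewrite !(mulr0, mul0r).
have Wp : 0 < overlap a b i j by rewrite lt_neqAle eq_sym Wn0 overlap_ge0.
rewrite mulrAC ler_pM2r //; apply: relent_ge_sub => // li; exact: ac Wp.
Qed.

Lemma chi_ge0 (X J : finType) (p : X -> R) (tau : X -> op R J) :
  pmf p -> (forall x, density (tau x)) -> 0 <= chi p tau.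
Proof.
move=> pp td; have wd := density_mix pp td.
have [f fP] := boolp.choice (fun x => psd_eigdP (td x).1).
have [[mu b] /= wb] := psd_eigdP wd.1.
rewrite -(pmulr_rge0 _ (ln2_gt0 R)) -(llr_mix pp td fP wb).
apply: sumr_ge0 => x _; have [->|px0] := eqVneq (p x) 0; first by rewrite mul0r.
have px : 0 < p x by rewrite lt_neqAle eq_sym px0 pp.1.
rewrite mulr_ge0 ?pp.1 //; apply: llr_ge0.
- exact: (fP x).1.
- exact: wb.1.
- exact: density_pmf (td x) (fP x).
- exact: density_pmf wd wb.
by move=> i j; apply: (mix_support pp.1 px _ (fP x) wb) => y; case: (td y).
Qed.

Lemma eigd_tens (I K : finType) (A : op R I) (B : op R K) mu u nu w :
  eigd A mu u -> eigd B nu w ->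
  eigd (tensop A B) (fun t => mu t.1 * nu t.2) (fun t s => u t.1 s.1 * w t.2 s.2).
Proof.
move=> Au Bw; have pairE (F : I -> C) (G : K -> C) :
    \sum_(t : I * K) F t.1 * G t.2 = (\sum_i F i) * (\sum_k G k).
  by rewrite big_distrlr /= pair_bigA.
split; first split.
- move=> [i k] [i' k']; rewrite /ip /= xpair_eqE.
  rewrite (eq_bigr (fun t : I * K =>
    ((u i t.1)^* * u i' t.1) * ((w k t.2)^* * w k' t.2))).
    rewrite (pairE (fun x => (u i x)^* * u i' x) (fun y => (w k y)^* * w k' y)).
    rewrite -/(ip _ _) Au.1.1 -/(ip _ _) Bw.1.1.
    by case: eqP; case: eqP; rewrite ?(mul0r, mulr0, mul1r).
  by move=> t _; rewrite conjM mulrACA.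
- move=> [i k] [i' k']; rewrite xpair_eqE /=.
  rewrite (eq_bigr (fun t : I * K =>
    (u t.1 i * (u t.1 i')^*) * (w t.2 k * (w t.2 k')^*))).
    rewrite (pairE (fun x => u x i * (u x i')^*) (fun y => w y k * (w y k')^*)).
    by rewrite Au.1.2 Bw.1.2; case: eqP; case: eqP; rewrite ?(mul0r, mulr0, mul1r).
  by move=> t _; rewrite conjM mulrACA.
move=> [i k] [i' k']; rewrite /tensop /= Au.2 Bw.2.
rewrite -(pairE (fun x => RtoC (mu x) * (u x i * (u x i')^*))
  (fun y => RtoC (nu y) * (w y k * (w y k')^*))).
by apply: eq_bigr => t _; rewrite rmorphM conjM; ring.
Qed.

Lemma psd_tens (I K : finType) (A : op R I) (B : op R K) :
  psd A -> psd B -> psd (tensop A B).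
Proof.
move=> A0 B0; have [mu [u Au]] := psd_eigd A0; have [nu [w Bw]] := psd_eigd B0.
apply: (eigd_psd (eigd_tens Au Bw)) => t.
by rewrite mulr_ge0 // ?(eigd_ge0 _ Au) // (eigd_ge0 _ Bw).
Qed.

Lemma sum_pair (V : nmodType) (I K : finType) (F : I * K -> V) :
  \sum_t F t = \sum_i \sum_k F (i, k).
Proof. by rewrite pair_bigA; apply: eq_bigr => -[]. Qed.

Lemma psd_trace_mul (I : finType) (T A : op R I) : psd T -> psd A ->
  0 <= trace (mulop T A).
Proof.
move=> T0 A0; have [mu [u Au]] := psd_eigd A0.
by apply: (psd_trace_mul_ge0 T0 Au) => j; apply: eigd_ge0 Au A0.
Qed.

Definition marg1 (I K : finType) (A : op R (I * K)%type) : op R I :=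
  fun i i' => \sum_k A (i, k) (i', k).
Definition marg2 (I K : finType) (A : op R (I * K)%type) : op R K :=
  fun k k' => \sum_i A (i, k) (i, k').

Lemma trace_mul_marg1 (I K : finType) (L : op R I) (A : op R (I * K)%type) :
  trace (mulop L (marg1 A)) = trace (mulop (tensop L (@idop R K)) A).
Proof.
rewrite /trace /mulop /marg1 [RHS]sum_pair.
apply: eq_bigr => i _; under eq_bigr do rewrite mulr_sumr.
rewrite exchange_big /=; apply: eq_bigr => k _.
rewrite [RHS]sum_pair.
apply: eq_bigr => i' _; rewrite -(sum_delta k (fun k' => L i i' * A (i', k') (i, k))).
by apply: eq_bigr => k' _; rewrite /tensop /idop /=; ring.
Qed.

Lemma trace_mul_marg2 (I K : finType) (L : op R K) (A : op R (I * K)%type) :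
  trace (mulop L (marg2 A)) = trace (mulop (tensop (@idop R I) L) A).
Proof.
rewrite /trace /mulop /marg2 [RHS]sum_pair [RHS]exchange_big /=.
apply: eq_bigr => k _; under eq_bigr do rewrite mulr_sumr.
rewrite exchange_big /=; apply: eq_bigr => i _.
rewrite [RHS]sum_pair [RHS]exchange_big /=.
apply: eq_bigr => k' _; rewrite -(sum_delta i (fun i' => L k k' * A (i', k') (i, k))).
by apply: eq_bigr => i' _; rewrite /tensop /idop /=; ring.
Qed.

Lemma trace_mulopDl (I : finType) (A B D : op R I) :
  trace (mulop (fun i j => A i j + B i j) D) = trace (mulop A D) + trace (mulop B D).
Proof.
rewrite /trace -big_split; apply: eq_bigr => i _; rewrite -big_split.
by apply: eq_bigr => j _; rewrite mulrDl.
Qed.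

Lemma idop_tens (I K : finType) : tensop (@idop R I) (@idop R K) = @idop R _.
Proof.
apply: funext => -[i k]; apply: funext => -[i' k']; rewrite /tensop /idop xpair_eqE /=.
by case: eqP; case: eqP; rewrite ?(mul0r, mulr0, mul1r).
Qed.

Lemma psd_idop (I : finType) : psd (@idop R I).
Proof.
move=> v; apply: sumr_ge0 => i _.
under eq_bigr do rewrite /idop -mulrA mulrCA.
by rewrite sum_delta mulrC mul_conjC_ge0.
Qed.

(** 1 - L (x) G = (1 - L) (x) 1 + L (x) (1 - G), and the second summand is positive: decoding one
    message fails no more often than decoding both. *)
Lemma error_marg1 (I K : finType) (L : op R I) (G : op R K) (A : op R (I * K)%type) :
  psd L -> psd (subop (@idop R K) G) -> psd A ->
  trace (mulop (subop (@idop R I) L) (marg1 A)) <=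
  trace (mulop (subop (@idop R _) (tensop L G)) A).
Proof.
move=> L0 G0 A0; rewrite trace_mul_marg1 -idop_tens.
rewrite (_ : subop (tensop _ _) _ = fun i j =>
    tensop (subop (@idop R I) L) (@idop R K) i j + tensop L (subop (@idop R K) G) i j).
  rewrite trace_mulopDl lerDl.
  by apply: psd_trace_mul => //; apply: psd_tens.
by apply: funext => i; apply: funext => j; rewrite /subop /tensop; ring.
Qed.

(** The other splitting: 1 - L (x) G = 1 (x) (1 - G) + (1 - L) (x) G. *)
Lemma error_marg2 (I K : finType) (L : op R I) (G : op R K) (A : op R (I * K)%type) :
  psd (subop (@idop R I) L) -> psd G -> psd A ->
  trace (mulop (subop (@idop R K) G) (marg2 A)) <=
  trace (mulop (subop (@idop R _) (tensop L G)) A).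
Proof.
move=> L0 G0 A0; rewrite trace_mul_marg2 -idop_tens.
rewrite (_ : subop (tensop _ _) _ = fun i j =>
    tensop (@idop R I) (subop (@idop R K) G) i j + tensop (subop (@idop R I) L) G i j).
  rewrite trace_mulopDl lerDl.
  by apply: psd_trace_mul => //; apply: psd_tens.
by apply: funext => i; apply: funext => j; rewrite /subop /tensop; ring.
Qed.

(** Positivity by duality: <v, marg1 A v> is the trace of A against the positive operator |v><v| (x)
    1. *)
Lemma density_marg1 (I K : finType) (A : op R (I * K)%type) :
  density A -> density (marg1 A).
Proof.
move=> [A0 A1]; split; last by rewrite -A1 [RHS]/trace sum_pair.
move=> v; rewrite (_ : \sum_i _ = trace (mulop (fun i j => v i * (v j)^*) (marg1 A))).
  rewrite trace_mul_marg1; apply: psd_trace_mul => //.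
  apply: psd_tens; last exact: psd_idop.
  move=> w; rewrite (_ : \sum_i _ = ip w v * (ip w v)^*) ?mul_conjC_ge0 //.
  rewrite /ip conj_sum big_distrlr /=.
  by apply: eq_bigr => i _; apply: eq_bigr => j _; rewrite conjM conjCK; ring.
rewrite /trace /mulop exchange_big /=.
by apply: eq_bigr => i _; apply: eq_bigr => j _; ring.
Qed.

Lemma density_marg2 (I K : finType) (A : op R (I * K)%type) :
  density A -> density (marg2 A).
Proof.
move=> [A0 A1]; split.
  move=> v; rewrite (_ : \sum_i _ = trace (mulop (fun i j => v i * (v j)^*) (marg2 A))).
    rewrite trace_mul_marg2; apply: psd_trace_mul => //.
    apply: psd_tens; first exact: psd_idop.
    move=> w; rewrite (_ : \sum_i _ = ip w v * (ip w v)^*) ?mul_conjC_ge0 //.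
    rewrite /ip conj_sum big_distrlr /=.
    by apply: eq_bigr => i _; apply: eq_bigr => j _; rewrite conjM conjCK; ring.
  rewrite /trace /mulop exchange_big /=.
  by apply: eq_bigr => i _; apply: eq_bigr => j _; ring.
by rewrite -A1 [RHS]/trace sum_pair exchange_big.
Qed.

(** Change of index set. It mediates between [chan_n], which acts on pairs of words, and [prodop],
    which acts on words of pairs. *)
Definition relabel (I I' : finType) (phi : I' -> I) (A : op R I) : op R I' :=
  fun i j => A (phi i) (phi j).

Lemma psd_relabel (I I' : finType) (phi : I' -> I) (A : op R I) :
  bijective phi -> psd A -> psd (relabel phi A).
Proof.
move=> [psi K1 K2] A0 v; have := A0 (v \o psi).
have bp : bijective phi by exists psi.
rewrite (reindex phi) /=; last exact: onW_bij.
congr (0 <= _); apply: eq_bigr => i _; rewrite (reindex phi) /=; last exact: onW_bij.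
by apply: eq_bigr => j _; rewrite !K1.
Qed.

Lemma trace_mul_relabel (I I' : finType) (phi : I' -> I) (A B : op R I) :
  bijective phi ->
  trace (mulop (relabel phi A) (relabel phi B)) = trace (mulop A B).
Proof.
move=> bp; rewrite /trace [RHS](reindex phi) /=; last exact: onW_bij.
apply: eq_bigr => i _; rewrite /mulop [RHS](reindex phi) //=.
exact: onW_bij.
Qed.

Lemma relabel_idop (I I' : finType) (phi : I' -> I) :
  bijective phi -> relabel phi (@idop R I) = @idop R I'.
Proof.
move=> bp; apply: funext => i; apply: funext => j.
by rewrite /relabel /idop (inj_eq (bij_inj bp)).
Qed.

Lemma povm_relabel (M I I' : finType) (phi : I' -> I) (L : M -> op R I) :
  bijective phi -> povm L -> povm (fun m => relabel phi (L m)).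
Proof.
move=> bp [L0 L1]; split=> [m|i j]; first exact: psd_relabel.
by rewrite -(relabel_idop bp) /relabel L1.
Qed.

Lemma povm_tens (M1 M2 I K : finType) (L : M1 -> op R I) (G : M2 -> op R K) :
  povm L -> povm G -> povm (fun m : M1 * M2 => tensop (L m.1) (G m.2)).
Proof.
move=> [L0 L1] [G0 G1]; split=> [m|[i k] [i' k']]; first exact: psd_tens.
rewrite -idop_tens /tensop /= -L1 -G1 big_distrlr /= pair_bigA.
by apply: eq_bigr.
Qed.

End Bipartite.

(** * Converse bounds for codes, with empirical input distributions *)

Section Codes.
Variable R : realType.
Local Notation C := R[i].
Local Notation RtoC := (@RtoC R).

(** If [eps] * #|A| < 1, the left side is at most 0 while the right side is at least 1, since Holevo
    quantities are nonnegative. *)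
Lemma converse_chi (A Y J K : finType) (tau : A -> Y -> K -> op R J)
    (T : A -> op R {ffun K -> J}) (eps : R) :
  (forall a y k, density (tau a y k)) -> povm T ->
  (0 < #|A|)%N -> (0 < #|Y|)%N -> 0 < eps -> 4 * eps <= 1 ->
  \sum_a \sum_y trace (mulop (subop (@idop R _) (T a)) (prodop (tau a y)))
    <= RtoC (eps * (#|A| * #|Y|)%:R) ->
  ln (eps * #|A|%:R) * (1 - 4 * eps) <= 1 + ln 2 *
    \sum_k \sum_y #|Y|%:R^-1 * chi (fun=> #|A|%:R^-1) (fun a => tau a y k).
Proof.
move=> td Tp A0 Y0 e0 e4 err; have [g1|g1] := leP 1 (eps * #|A|%:R).
  exact: converse_chi_ge1 err.
have unifP : pmf (fun _ : A => #|A|%:R^-1 : R).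
  split=> [a|]; first by rewrite invr_ge0 ler0n.
  by rewrite sumr_const -[LHS]mulr_natl mulfV // pnatr_eq0 -lt0n.
have lg : ln (eps * #|A|%:R) <= 0 by apply: ln_le0; apply: ltW.
have : 0 <= ln 2 *
    \sum_k \sum_y #|Y|%:R^-1 * chi (fun=> #|A|%:R^-1) (fun a => tau a y k) :> R.
  rewrite mulr_ge0 ?(ltW (ln2_gt0 R)) //; apply: sumr_ge0 => k _; apply: sumr_ge0 => y _.
  by rewrite mulr_ge0 ?invr_ge0 ?ler0n // chi_ge0.
have : ln (eps * #|A|%:R) * (1 - 4 * eps) <= 0 by rewrite mulr_le0_ge0 //; lra.
lra.
Qed.

Definition emp (A X : finType) (e : A -> X) (x : X) : R :=
  #|A|%:R^-1 * \sum_a (e a == x)%:R.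

Lemma emp_pmf (A X : finType) (e : A -> X) : (0 < #|A|)%N -> pmf (emp e).
Proof.
move=> A0; split=> [x|].
  by rewrite mulr_ge0 ?invr_ge0 ?ler0n // sumr_ge0 // => a _; rewrite ler0n.
rewrite -mulr_sumr exchange_big /= (eq_bigr (fun=> 1)).
  by rewrite sumr_const mulVf // pnatr_eq0 -lt0n.
move=> a _; rewrite -[RHS](sum_delta (e a) (fun=> 1)).
by apply: eq_bigr => x _; rewrite mulr1.
Qed.

Lemma sum_fiber (V : comPzSemiRingType) (A X : finType) (e : A -> X) (F : X -> V) :
  \sum_a F (e a) = \sum_x (\sum_a (e a == x)%:R) * F x.
Proof.
under [RHS]eq_bigr do rewrite mulr_suml.
by rewrite exchange_big; apply: eq_bigr => a _; rewrite sum_delta.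
Qed.

Lemma sum_emp (A X : finType) (e : A -> X) (F : X -> R) :
  \sum_a #|A|%:R^-1 * F (e a) = \sum_x emp e x * F x.
Proof.
rewrite -mulr_sumr sum_fiber mulr_sumr.
by apply: eq_bigr => x _; rewrite mulrA.
Qed.

(** The Holevo quantity of a codebook depends only on the frequencies of its letters. *)
Lemma chi_emp (A X J : finType) (e : A -> X) (tau : X -> op R J) :
  chi (fun=> #|A|%:R^-1) (fun a => tau (e a)) = chi (emp e) tau.
Proof.
rewrite /chi (sum_emp e (fun x => vN_entropy (tau x))); congr (vN_entropy _ - _).
apply: funext => i; apply: funext => j; rewrite /mixop.
rewrite -mulr_sumr (sum_fiber e (fun x => tau x i j)) mulr_sumr; apply: eq_bigr => x _.
rewrite /emp rmorphM rmorph_sum /= mulrA; congr (_ * _ * _).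
by apply: eq_bigr => a _; rewrite rmorph_nat.
Qed.

(** Independent uniform messages induce a product distribution on the letter pairs, which is the
    form of input that the Sato region allows. *)
Lemma emp_pair (A1 A2 X1 X2 : finType) (e1 : A1 -> X1) (e2 : A2 -> X2) :
  emp (fun m : A1 * A2 => (e1 m.1, e2 m.2)) =
  (fun x => emp e1 x.1 * emp e2 x.2).
Proof.
apply: funext => -[x1 x2]; rewrite /emp card_prod natrM invfM /= mulrACA.
congr (_ * _); rewrite big_distrlr /= pair_bigA; apply: eq_bigr => m _.
by rewrite xpair_eqE; case: eqP; case: eqP; rewrite ?(mul0r, mulr0, mul1r).
Qed.

Section Channel.
Variables (X1 X2 J1 J2 : finType) (rho : X1 -> X2 -> op R (J1 * J2)%type).

(** The three [holevo] functions are the mutual informations I(X1;B1|X2), I(X2;B2|X1) and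
    I(X1X2;B1B2) for one value of the time-sharing variable. *)
Definition holevo1 (p : X1 -> R) (p' : X2 -> R) : R :=
  \sum_x2 p' x2 * chi p (fun x1 => marg1 (rho x1 x2)).
Definition holevo2 (p : X1 -> R) (p' : X2 -> R) : R :=
  \sum_x1 p x1 * chi p' (fun x2 => marg2 (rho x1 x2)).
Definition holevo12 (p : X1 -> R) (p' : X2 -> R) : R :=
  chi (fun x : X1 * X2 => p x.1 * p' x.2) (fun x => rho x.1 x.2).

Definition unzipf (n : nat) (f : {ffun 'I_n -> J1 * J2}) :
    {ffun 'I_n -> J1} * {ffun 'I_n -> J2} :=
  ([ffun k => (f k).1], [ffun k => (f k).2]).

Lemma unzipf_bij n : bijective (@unzipf n).
Proof.
exists (fun fg : {ffun 'I_n -> J1} * {ffun 'I_n -> J2} => [ffun k => (fg.1 k, fg.2 k)]).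
  by move=> f; apply/ffunP => k; rewrite !ffunE; case: (f k).
by move=> [f g]; congr pair; apply/ffunP => k; rewrite !ffunE.
Qed.

Lemma chan_n_relabel n (x1s : 'I_n -> X1) (x2s : 'I_n -> X2) :
  relabel (@unzipf n) (chan_n rho x1s x2s) = prodop (fun k => rho (x1s k) (x2s k)).
Proof.
apply: funext => f; apply: funext => g; apply: eq_bigr => k _.
by rewrite /unzipf /= !ffunE -!surjective_pairing.
Qed.

Lemma chan_n_marg1 n (x1s : 'I_n -> X1) (x2s : 'I_n -> X2) :
  marg1 (chan_n rho x1s x2s) = prodop (fun k => marg1 (rho (x1s k) (x2s k))).
Proof.
apply: funext => f; apply: funext => g.
by rewrite /prodop /marg1 bigA_distr_bigA.
Qed.

Lemma chan_n_marg2 n (x1s : 'I_n -> X1) (x2s : 'I_n -> X2) :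
  marg2 (chan_n rho x1s x2s) = prodop (fun k => marg2 (rho (x1s k) (x2s k))).
Proof.
apply: funext => f; apply: funext => g.
by rewrite /prodop /marg2 bigA_distr_bigA.
Qed.

Lemma psd_prodop (K J : finType) (A : K -> op R J) :
  (forall k, psd (A k)) -> psd (prodop A).
Proof.
move=> A0; have [f fP] := boolp.choice (fun k => psd_eigdP (A0 k)).
apply: (eigd_psd (eigd_prod fP)) => g; apply: prodr_ge0 => k _.
exact: eigd_ge0 (fP k) (A0 k).
Qed.

Hypothesis rho_cq : cq_ic rho.

Lemma psd_chan_n n (x1s : 'I_n -> X1) (x2s : 'I_n -> X2) : psd (chan_n rho x1s x2s).
Proof.
have [psi K1 K2] := unzipf_bij n.
have -> : chan_n rho x1s x2s = relabel psi (relabel (@unzipf n) (chan_n rho x1s x2s)).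
  by apply: funext => f; apply: funext => g; rewrite /relabel !K2.
apply: psd_relabel; first by exists (@unzipf n).
by rewrite chan_n_relabel; apply: psd_prodop => k; apply: (rho_cq _ _).1.
Qed.

(** Three applications of [converse_chi]: each receiver separately, on its marginal state and
    averaged over the message of the other sender, then both receivers jointly, with the tensor
    product POVM and a trivial [Y]. *)
Lemma code_bounds n M1 M2 (e1 : 'I_M1 -> 'I_n -> X1) (e2 : 'I_M2 -> 'I_n -> X2)
    (L : 'I_M1 -> op R {ffun 'I_n -> J1}) (G : 'I_M2 -> op R {ffun 'I_n -> J2})
    (eps : R) :
  (0 < M1)%N -> (0 < M2)%N -> 0 < eps -> 4 * eps <= 1 -> povm L -> povm G ->
  code_error rho e1 e2 L G <= RtoC eps ->
  let p1 k := emp (fun m => e1 m k) in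
  let p2 k := emp (fun m => e2 m k) in
  [/\ ln (eps * M1%:R) * (1 - 4 * eps) <= 1 + ln 2 * \sum_k holevo1 (p1 k) (p2 k),
      ln (eps * M2%:R) * (1 - 4 * eps) <= 1 + ln 2 * \sum_k holevo2 (p1 k) (p2 k) &
      ln (eps * (M1 * M2)%:R) * (1 - 4 * eps) <=
        1 + ln 2 * \sum_k holevo12 (p1 k) (p2 k)].
Proof.
move=> M1p M2p e0 e4 Lp Gp err p1 p2.
have N0 : 0 < (M1 * M2)%:R :> R by rewrite ltr0n muln_gt0 M1p.
pose err_ m1 m2 := trace (mulop (subop (@idop R _) (tensop (L m1) (G m2)))
  (chan_n rho (e1 m1) (e2 m2))).
have {}err : \sum_m1 \sum_m2 err_ m1 m2 <= RtoC (eps * (M1 * M2)%:R).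
  have N0' : 0 <= RtoC (M1 * M2)%:R by rewrite (ler_RtoC 0) ltW.
  have := ler_wpM2l N0' err; rewrite /code_error mulrA -rmorphM mulfV ?gt_eqF //.
  by rewrite rmorph1 mul1r -rmorphM /= mulrC.
split.
(* Receiver 1: decode [m1], average over [m2]. *)
- have := @converse_chi _ _ _ _ (fun m1 m2 k => marg1 (rho (e1 m1 k) (e2 m2 k))) L eps.
  rewrite !card_ord => /(_ _ Lp M1p M2p e0 e4) H.
  suff <- : \sum_k \sum_y M2%:R^-1 * chi (fun=> M1%:R^-1)
      (fun a => marg1 (rho (e1 a k) (e2 y k))) = \sum_k holevo1 (p1 k) (p2 k).
    apply: H; first by move=> *; apply/density_marg1/rho_cq.
    apply: le_trans err; apply: ler_sum => m1 _; apply: ler_sum => m2 _.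
    rewrite -chan_n_marg1; apply: error_marg1; first exact: Lp.1.
      exact: psd_idop_sub.
    exact: psd_chan_n.
  apply: eq_bigr => k _; rewrite /holevo1 -sum_emp card_ord; apply: eq_bigr => m2 _.
  congr (_ * _); rewrite -[RHS](chi_emp (fun a => e1 a k) (fun x => marg1 (rho x _))).
  by rewrite card_ord.
(* Receiver 2: the roles of [m1] and [m2] are exchanged. *)
- have := @converse_chi _ _ _ _ (fun m2 m1 k => marg2 (rho (e1 m1 k) (e2 m2 k))) G eps.
  rewrite !card_ord => /(_ _ Gp M2p M1p e0 e4) H.
  suff <- : \sum_k \sum_y M1%:R^-1 * chi (fun=> M2%:R^-1)
      (fun a => marg2 (rho (e1 y k) (e2 a k))) = \sum_k holevo2 (p1 k) (p2 k).
    apply: H; first by move=> *; apply/density_marg2/rho_cq.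
    rewrite mulnC exchange_big; apply: le_trans err.
    apply: ler_sum => m1 _; apply: ler_sum => m2 _.
    rewrite -chan_n_marg2; apply: error_marg2; first exact: psd_idop_sub.
      exact: Gp.1.
    exact: psd_chan_n.
  apply: eq_bigr => k _; rewrite /holevo2 -sum_emp card_ord; apply: eq_bigr => m1 _.
  congr (_ * _); rewrite -[RHS](chi_emp (fun a => e2 a k) (fun x => marg2 (rho _ x))).
  by rewrite card_ord.
(* Sum rate: the pair of messages is decoded from both outputs together. *)
have bij := unzipf_bij n; have LGp := povm_relabel bij (povm_tens Lp Gp).
have := @converse_chi _ unit _ _
  (fun m _ k => rho (e1 m.1 k) (e2 m.2 k)) _ eps _ LGp.
rewrite card_prod !card_ord card_unit muln1 muln_gt0 M1p M2p => /(_ _ isT isT e0 e4) H.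
suff <- : \sum_(k < n) \sum_(y : unit) 1%:R^-1 *
    chi (fun _ : 'I_M1 * 'I_M2 => (M1 * M2)%:R^-1)
    (fun m => rho (e1 m.1 k) (e2 m.2 k)) = \sum_k holevo12 (p1 k) (p2 k).
  apply: H; first by move=> *; apply: rho_cq.
  apply: le_trans err; rewrite le_eqVlt; apply/orP; left; apply/eqP.
  rewrite [RHS]pair_bigA; apply: eq_bigr => m _ /=.
  rewrite big_const card_unit /= addr0 -chan_n_relabel -(relabel_idop R bij).
  exact: (trace_mul_relabel (subop _ _) _ bij).
apply: eq_bigr => k _; rewrite big_const card_unit /= addr0 invr1 mul1r /holevo12.
rewrite -(emp_pair (fun a => e1 a k) (fun a => e2 a k)).
rewrite -[RHS](chi_emp _ (fun x => rho x.1 x.2)).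
by rewrite card_prod !card_ord.
Qed.

End Channel.
End Codes.

(** * Entropies of the state theta *)

Section Theta.
Variable R : realType.
Local Notation C := R[i].
Local Notation RtoC := (@RtoC R).

Definition diagop (S : finType) (p : S -> R) : op R S :=
  fun c c' => (c == c')%:R * RtoC (p c).

Definition cqop (S J : finType) (p : S -> R) (s : S -> op R J) : op R (S * J)%type :=
  fun t t' => (t.1 == t'.1)%:R * (RtoC (p t.1) * s t.1 t.2 t'.2).

Lemma eigd_diagop (S : finType) (p : S -> R) :
  eigd (diagop p) p (fun c c' => (c == c')%:R).
Proof.
split; first split.
- move=> j j'; rewrite /ip (eq_bigr (fun i => (j == i)%:R * (j' == i)%:R)).
    by rewrite sum_delta eq_sym.
  by move=> i _; rewrite conjC_nat.
- move=> i i'; rewrite (eq_bigr (fun j => (i == j)%:R * (j == i')%:R)) ?sum_delta //.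
  by move=> j _; rewrite conjC_nat [j == i]eq_sym.
move=> i i'; rewrite (eq_bigr (fun j => (i == j)%:R * ((j == i')%:R * RtoC (p j)))).
  by rewrite sum_delta.
by move=> j _; rewrite conjC_nat [j == i]eq_sym; ring.
Qed.

Lemma entropy_diagop (S : finType) (p : S -> R) : (forall c, 0 <= p c) ->
  vN_entropy (diagop p) = - \sum_c eta2 (p c).
Proof.
by move=> p0; have Ap := eigd_diagop p; apply: vN_entropy_eigd (eigd_psd Ap p0) Ap.
Qed.

Lemma natr_and (a b : bool) : (a && b)%:R = a%:R * b%:R :> C.
Proof. by case: a; rewrite ?mul1r ?mul0r. Qed.

Lemma eigd_cqop (S J : finType) (p : S -> R) (s : S -> op R J) lam u :
  (forall c, eigd (s c) (lam c) (u c)) ->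
  eigd (cqop p s) (fun t => p t.1 * lam t.1 t.2)
    (fun t t' => (t.1 == t'.1)%:R * u t.1 t.2 t'.2).
Proof.
move=> su; split; first split.
- move=> [c j] [c' j']; rewrite /ip sum_pair /= xpair_eqE natr_and.
  rewrite (eq_bigr (fun x => (c == x)%:R * ((c' == x)%:R * ip (u c j) (u c' j')))).
    rewrite sum_delta [c' == c]eq_sym; have [->|] := eqVneq c c'; last by rewrite !mul0r.
    by rewrite (su c').1.1.
  move=> x _; rewrite /ip !mulr_sumr; apply: eq_bigr => y _.
  by rewrite conjM conjC_nat; ring.
- move=> [c j] [c' j']; rewrite sum_pair /= xpair_eqE natr_and.
  rewrite (eq_bigr (fun x => (c == x)%:R * ((x == c')%:R *
    \sum_y u x y j * (u x y j')^*))).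
    by rewrite sum_delta (su c).1.2.
  move=> x _; rewrite !mulr_sumr; apply: eq_bigr => y _.
  by rewrite conjM conjC_nat [x == c]eq_sym; ring.
move=> [c j] [c' j']; rewrite /cqop sum_pair /= (su c).2.
rewrite [RHS](eq_bigr (fun x => (c == x)%:R * ((x == c')%:R *
    \sum_y RtoC (p x * lam x y) * (u x y j * (u x y j')^*)))).
  rewrite sum_delta !mulr_sumr; apply: eq_bigr => y _.
  by rewrite rmorphM; ring.
move=> x _; rewrite !mulr_sumr; apply: eq_bigr => y _.
by rewrite conjM conjC_nat [x == c]eq_sym; ring.
Qed.

Lemma eta2M (x y : R) : 0 <= x -> 0 <= y ->
  eta2 (x * y) = x * eta2 y + y * eta2 x.
Proof.
move=> x0 y0; rewrite !eta2E.
have [->|xn] := eqVneq x 0; first by rewrite !(mul0r, mulr0) addr0.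
have [->|yn] := eqVneq y 0; first by rewrite !(mul0r, mulr0) addr0.
by rewrite lnM ?posrE ?lt_neqAle ?[0 == _]eq_sym ?xn ?yn //; ring.
Qed.

(** Chain rule: the eigenvalues are the products p_c lam_cj, and the logarithm of a product
    splits. *)
Lemma entropy_cqop (S J : finType) (p : S -> R) (s : S -> op R J) :
  (forall c, 0 <= p c) -> (forall c, density (s c)) ->
  vN_entropy (cqop p s) = \sum_c p c * vN_entropy (s c) - \sum_c eta2 (p c).
Proof.
move=> p0 sd; have [f fP] := boolp.choice (fun c => psd_eigdP (sd c).1).
have Ap := eigd_cqop p fP; have fp c := density_pmf (sd c) (fP c).
rewrite (vN_entropy_eigd (eigd_psd Ap _) Ap).
  rewrite sum_pair -sumrB -sumrN; apply: eq_bigr => c _ /=.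
  rewrite (vN_entropy_eigd (sd c).1 (fP c)).
  under eq_bigr do rewrite eta2M ?(fp c).1 //.
  by rewrite big_split /= -mulr_sumr -mulr_suml (fp c).2; ring.
by move=> t; rewrite mulr_ge0 // (fp t.1).1.
Qed.

Lemma pmf_prod (X1 X2 : finType) (p : X1 -> R) (p' : X2 -> R) : pmf p -> pmf p' ->
  pmf (fun x : X1 * X2 => p x.1 * p' x.2).
Proof.
move=> [p0 p1] [p0' p1']; split=> [x|]; first exact: mulr_ge0.
rewrite sum_pair -[RHS]p1; apply: eq_bigr => x1 _ /=.
by rewrite -mulr_sumr p1' mulr1.
Qed.

(** Given an inverse of the relabelling, each inner sum has a single term. *)
Lemma ptrE (T S D : finType) (f : T -> S * D) (g : S * D -> T) (A : op R T) :
  cancel f g -> cancel g f ->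
  ptr f A = fun s s' => \sum_d A (g (s, d)) (g (s', d)).
Proof.
move=> fK gK; apply: funext => s; apply: funext => s'; apply: eq_bigr => d _.
have fE t u : (f t == u) = (t == g u).
  by apply/eqP/eqP => [<-|->]; rewrite ?fK ?gK.
rewrite (eq_bigl (pred1 (g (s, d)))) ?big_pred1_eq; last by move=> t; rewrite /= fE.
by rewrite (eq_bigl (pred1 (g (s', d)))) ?big_pred1_eq // => t; rewrite /= fE.
Qed.

Section Ensemble.
Variables (X1 X2 J1 J2 Q : finType) (rho : X1 -> X2 -> op R (J1 * J2)%type).
Variables (pQ : Q -> R) (p1 : Q -> X1 -> R) (p2 : Q -> X2 -> R).
Hypotheses (rho_cq : cq_ic rho) (pQP : pmf pQ).
Hypotheses (p1P : forall q, pmf (p1 q)) (p2P : forall q, pmf (p2 q)).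

Local Notation th := (theta rho pQ p1 p2).
Local Notation pall := (fun c : Q * X1 * X2 => pQ c.1.1 * p1 c.1.1 c.1.2 * p2 c.1.1 c.2).

Lemma thetaE : th = cqop pall (fun c => rho c.1.2 c.2).
Proof.
apply: funext => -[[[q x1] x2] b]; apply: funext => -[[[q' x1'] x2'] b'].
rewrite /theta /cqop /= !xpair_eqE -andbA.
by case: ifP; rewrite ?mul1r ?mul0r.
Qed.

Lemma sum_p1 q : \sum_x1 RtoC (p1 q x1) = 1.
Proof. by rewrite -rmorph_sum /= (p1P q).2 rmorph1. Qed.

Lemma sum_p2 q : \sum_x2 RtoC (p2 q x2) = 1.
Proof. by rewrite -rmorph_sum /= (p2P q).2 rmorph1. Qed.

Lemma ptr_QX1X2 : ptr (@k_QX1X2 X1 X2 J1 J2 Q) th = diagop pall.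
Proof.
rewrite (ptrE (g := id)); [|by case=> [[[]]]..]; rewrite thetaE.
apply: funext => c; apply: funext => c'; rewrite /cqop /diagop /=.
by rewrite -!mulr_sumr -/(trace _) (rho_cq _ _).2 mulr1.
Qed.

Lemma ptr_all : ptr (@k_all X1 X2 J1 J2 Q) th = cqop pall (fun c => rho c.1.2 c.2).
Proof.
rewrite (ptrE (g := fst)); [|by case|by case=> ? []]; rewrite thetaE.
by apply: funext => c; apply: funext => c'; rewrite /= big_const card_unit /= addr0.
Qed.

Lemma ptr_QX1X2B1 : ptr (@k_QX1X2B1 X1 X2 J1 J2 Q) th =
  cqop pall (fun c => marg1 (rho c.1.2 c.2)).
Proof.
rewrite (ptrE (g := fun t => (t.1.1, (t.1.2, t.2)))); first last.
- by case=> [[[[]]]].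
- by case=> [[[? ?] ?] []].
rewrite thetaE; apply: funext => -[c j]; apply: funext => -[c' j'].
by rewrite /cqop /= -!mulr_sumr.
Qed.

Lemma ptr_QX1X2B2 : ptr (@k_QX1X2B2 X1 X2 J1 J2 Q) th =
  cqop pall (fun c => marg2 (rho c.1.2 c.2)).
Proof.
rewrite (ptrE (g := fun t => (t.1.1, (t.2, t.1.2)))); first last.
- by case=> [[[[]]]].
- by case=> [[[? ?] ?] []].
rewrite thetaE; apply: funext => -[c j]; apply: funext => -[c' j'].
by rewrite /cqop /= -!mulr_sumr.
Qed.

Lemma ptr_QX2B1 : ptr (@k_QX2B1 X1 X2 J1 J2 Q) th =
  cqop (fun c => pQ c.1 * p2 c.1 c.2)
    (fun c => mixop (p1 c.1) (fun x1 => marg1 (rho x1 c.2))).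
Proof.
rewrite (ptrE (g := fun t => (t.1.1.1, t.2.1, t.1.1.2, (t.1.2, t.2.2)))); first last.
- by case=> [[[? ?] ?] []].
- by case=> [[[? ?] ?] []].
rewrite thetaE; apply: funext => -[[q x2] j]; apply: funext => -[[q' x2'] j'].
rewrite /cqop /mixop /= sum_pair !mulr_sumr; apply: eq_bigr => x1 _.
rewrite /marg1 !mulr_sumr; apply: eq_bigr => k _ /=.
by rewrite !xpair_eqE eqxx andbT !rmorphM; ring.
Qed.

Lemma ptr_QX1B2 : ptr (@k_QX1B2 X1 X2 J1 J2 Q) th =
  cqop (fun c => pQ c.1 * p1 c.1 c.2)
    (fun c => mixop (p2 c.1) (fun x2 => marg2 (rho c.2 x2))).
Proof.
rewrite (ptrE (g := fun t => (t.1.1.1, t.1.1.2, t.2.1, (t.2.2, t.1.2)))); first last.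
- by case=> [[[? ?] ?] []].
- by case=> [[[? ?] ?] []].
rewrite thetaE; apply: funext => -[[q x1] j]; apply: funext => -[[q' x1'] j'].
rewrite /cqop /mixop /= sum_pair !mulr_sumr; apply: eq_bigr => x2 _.
rewrite /marg2 !mulr_sumr; apply: eq_bigr => k _ /=.
by rewrite !xpair_eqE eqxx andbT !rmorphM; ring.
Qed.

Lemma ptr_QB1B2 : ptr (@k_QB1B2 X1 X2 J1 J2 Q) th =
  cqop pQ (fun q => mixop (fun x : X1 * X2 => p1 q x.1 * p2 q x.2)
                          (fun x => rho x.1 x.2)).
Proof.
rewrite (ptrE (g := fun t => (t.1.1, t.2.1, t.2.2, t.1.2))); first last.
- by case=> [[? ?] []].
- by case=> [[[? ?] ?] []].
rewrite thetaE; apply: funext => -[q b]; apply: funext => -[q' b'].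
rewrite /cqop /mixop /= !mulr_sumr; apply: eq_bigr => x _.
by rewrite !xpair_eqE !eqxx !andbT !rmorphM; ring.
Qed.

Lemma ptr_QX2 : ptr (@k_QX2 X1 X2 J1 J2 Q) th = diagop (fun c => pQ c.1 * p2 c.1 c.2).
Proof.
rewrite (ptrE (g := fun t => (t.1.1, t.2.1.1, t.1.2, (t.2.1.2, t.2.2)))); first last.
- by case=> [[? ?] [[]]].
- by case=> [[[? ?] ?] []].
rewrite thetaE; apply: funext => -[q x2]; apply: funext => -[q' x2'].
(* The right side is multiplied by 1 = \sum_x1 p1 q x1, then by 1 = Tr rho, until both sides are the
   same iterated sum. *)
rewrite /diagop sum_pair sum_pair /= -[RHS]mulr1 -[X in _ = _ * X](sum_p1 q) mulr_sumr.
apply: eq_bigr => x1 _; rewrite -[RHS]mulr1 -[X in _ = _ * X](rho_cq x1 x2).2.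
rewrite [trace _]sum_pair mulr_sumr.
apply: eq_bigr => j1 _; rewrite mulr_sumr; apply: eq_bigr => j2 _.
by rewrite /cqop /= !xpair_eqE eqxx andbT !rmorphM; ring.
Qed.

Lemma ptr_QX1 : ptr (@k_QX1 X1 X2 J1 J2 Q) th = diagop (fun c => pQ c.1 * p1 c.1 c.2).
Proof.
rewrite (ptrE (g := fun t => (t.1.1, t.1.2, t.2.1.1, (t.2.1.2, t.2.2)))); first last.
- by case=> [[? ?] [[]]].
- by case=> [[[? ?] ?] []].
rewrite thetaE; apply: funext => -[q x1]; apply: funext => -[q' x1'].
rewrite /diagop sum_pair sum_pair /= -[RHS]mulr1 -[X in _ = _ * X](sum_p2 q) mulr_sumr.
apply: eq_bigr => x2 _; rewrite -[RHS]mulr1 -[X in _ = _ * X](rho_cq x1 x2).2.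
rewrite [trace _]sum_pair mulr_sumr.
apply: eq_bigr => j1 _; rewrite mulr_sumr; apply: eq_bigr => j2 _.
by rewrite /cqop /= !xpair_eqE eqxx andbT !rmorphM; ring.
Qed.

Lemma ptr_Q : ptr (@k_Q X1 X2 J1 J2 Q) th = diagop pQ.
Proof.
rewrite (ptrE (g := fun t => (t.1, t.2.1.1, t.2.1.2, t.2.2))); first last.
- by case=> [? [[]]].
- by case=> [[[]]].
rewrite thetaE; apply: funext => q; apply: funext => q'.
rewrite /diagop sum_pair sum_pair /= -[RHS]mulr1 -[X in _ = _ * X](sum_p1 q) mulr_sumr.
apply: eq_bigr => x1 _; rewrite -[RHS]mulr1 -[X in _ = _ * X](sum_p2 q) mulr_sumr.
apply: eq_bigr => x2 _; rewrite -[RHS]mulr1 -[X in _ = _ * X](rho_cq x1 x2).2 mulr_sumr.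
apply: eq_bigr => b _.
by rewrite /cqop /= !xpair_eqE !eqxx !andbT !rmorphM; ring.
Qed.

Lemma pall_ge0 c : 0 <= pall c.
Proof. by rewrite !mulr_ge0 ?(pQP.1) ?(p1P _).1 ?(p2P _).1. Qed.

(** By the chain rule each of the four entropies contains a classical part. These parts cancel in
    pairs, leaving a difference of mean output entropies, which is an average of Holevo
    quantities. *)
Lemma I_X1_B1_holevo :
  I_X1_B1_gX2Q rho pQ p1 p2 = \sum_q pQ q * holevo1 rho (p1 q) (p2 q).
Proof.
have md x1 x2 : density (marg1 (rho x1 x2)) by apply/density_marg1/rho_cq.
have p12 (c : Q * X2) : 0 <= pQ c.1 * p2 c.1 c.2 by rewrite mulr_ge0 ?pQP.1 ?(p2P _).1.
rewrite /I_X1_B1_gX2Q /Hth ptr_QX1X2 ptr_QX2B1 ptr_QX1X2B1 ptr_QX2.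
rewrite (entropy_cqop pall_ge0) // (entropy_cqop p12); last first.
  by move=> c; apply: density_mix.
rewrite !entropy_diagop //; last exact: pall_ge0.
set a := \sum_c eta2 _; set b := \sum_c eta2 _; set x := \sum_c _; set y := \sum_c _.
transitivity (x - y); first by ring.
rewrite /x /y !sum_pair -sumrB; apply: eq_bigr => q _ /=.
rewrite exchange_big -sumrB mulr_sumr; apply: eq_bigr => x2 _ /=.
rewrite /chi !mulrBr !mulr_sumr; congr (_ - _); first by ring.
by apply: eq_bigr => x1 _; ring.
Qed.

Lemma I_X2_B2_holevo :
  I_X2_B2_gX1Q rho pQ p1 p2 = \sum_q pQ q * holevo2 rho (p1 q) (p2 q).
Proof.
have md x1 x2 : density (marg2 (rho x1 x2)) by apply/density_marg2/rho_cq.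
have p12 (c : Q * X1) : 0 <= pQ c.1 * p1 c.1 c.2 by rewrite mulr_ge0 ?pQP.1 ?(p1P _).1.
rewrite /I_X2_B2_gX1Q /Hth ptr_QX1X2 ptr_QX1B2 ptr_QX1X2B2 ptr_QX1.
rewrite (entropy_cqop pall_ge0) // (entropy_cqop p12); last first.
  by move=> c; apply: density_mix.
rewrite !entropy_diagop //; last exact: pall_ge0.
set a := \sum_c eta2 _; set b := \sum_c eta2 _; set x := \sum_c _; set y := \sum_c _.
transitivity (x - y); first by ring.
rewrite /x /y !sum_pair -sumrB; apply: eq_bigr => q _ /=.
rewrite -sumrB mulr_sumr; apply: eq_bigr => x1 _ /=.
rewrite /chi !mulrBr !mulr_sumr; congr (_ - _); first by ring.
by apply: eq_bigr => x2 _; ring.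
Qed.

Lemma I_X1X2_B1B2_holevo :
  I_X1X2_B1B2_gQ rho pQ p1 p2 = \sum_q pQ q * holevo12 rho (p1 q) (p2 q).
Proof.
rewrite /I_X1X2_B1B2_gQ /Hth ptr_QX1X2 ptr_QB1B2 ptr_all ptr_Q.
rewrite (entropy_cqop pall_ge0) // (entropy_cqop pQP.1); last first.
  by move=> q; apply: density_mix => //; exact: pmf_prod.
rewrite (entropy_diagop pall_ge0) (entropy_diagop pQP.1).
set a := \sum_c eta2 _; set b := \sum_c eta2 _; set x := \sum_c _; set y := \sum_c _.
transitivity (x - y); first by ring.
rewrite /x /y !sum_pair -sumrB; apply: eq_bigr => q _ /=.
rewrite /holevo12 /chi mulrBr; congr (_ - _).
rewrite pair_bigA mulr_sumr; apply: eq_bigr => c _ /=; ring.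
Qed.

End Ensemble.
End Theta.

(** * Closedness of the Sato region *)

Section Semicontinuity.
Variable R : realType.
Local Notation C := R[i].
Local Notation RtoC := (@RtoC R).

(* Klein's inequality, read as: the entropy is an infimum of functionals linear
   in the state, hence upper semicontinuous. *)
Lemma entropy_le_cross (I : finType) (A : op R I) b (c : I -> R) :
  density A -> onb b -> \sum_j expR (- c j) <= 1 ->
  ln 2 * vN_entropy A <= \sum_j c j * complex.Re (qf A (b j)).
Proof.
move=> Ad bo c1; have [[lam a] /= Aa] := psd_eigdP Ad.1.
have [lam0 lam1] := density_pmf Ad Aa.
rewrite (ln2_entropy Ad.1 Aa).
(* The numbers exp(-c_j) act as a subnormalized second spectrum in the basis [b]. *)
have H : \sum_i \sum_j (lam i - expR (- c j)) * overlap a b i j <=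
    \sum_i \sum_j lam i * (ln (lam i) + c j) * overlap a b i j.
  apply: ler_sum => i _; apply: ler_sum => j _.
  apply: ler_wpM2r; first exact: overlap_ge0.
  have := @relent_ge_sub _ (lam i) (expR (- c j)) (lam0 i) (expR_ge0 _)
    (fun=> expR_gt0 _).
  by rewrite expRK opprK.
have e1 : \sum_i \sum_j (lam i - expR (- c j)) * overlap a b i j =
    1 - \sum_j expR (- c j).
  under eq_bigr do under eq_bigr do rewrite mulrBl.
  under eq_bigr do rewrite sumrB -mulr_sumr (overlap_sumr _ Aa.1 bo) mulr1.
  rewrite sumrB lam1 exchange_big /=; congr (_ - _).
  by apply: eq_bigr => j _; rewrite -mulr_sumr (overlap_suml _ Aa.1 bo) mulr1.
have e2 : \sum_i \sum_j lam i * (ln (lam i) + c j) * overlap a b i j =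
    \sum_i lam i * ln (lam i) + \sum_j c j * complex.Re (qf A (b j)).
  under eq_bigr do under eq_bigr do rewrite mulrDr mulrDl.
  under eq_bigr do rewrite big_split /= -mulr_sumr (overlap_sumr _ Aa.1 bo) mulr1.
  rewrite big_split exchange_big /=; congr (_ + _); apply: eq_bigr => j _.
  rewrite (qf_eigd _ Aa) /= mulr_sumr; apply: eq_bigr => i _.
  by rewrite -/(overlap a b i j); ring.
move: H; rewrite e1 e2; lra.
Qed.

(** The optimal choice is the eigenbasis with c_j = - ln mu_j. To keep c_j finite at zero
    eigenvalues, mu_j is smoothed to (mu_j + t) / (1 + d t) with d the dimension. *)
Lemma entropy_cross_attained (I : finType) (A : op R I) (e : R) :
  density A -> 0 < e -> exists b c, [/\ onb b, \sum_j expR (- c j) <= 1 &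
    \sum_j c j * complex.Re (qf A (b j)) <= ln 2 * vN_entropy A + e].
Proof.
move=> Ad e0; have [[mu b] /= Ab] := psd_eigdP Ad.1.
have [mu0 mu1] := density_pmf Ad Ab.
pose d : R := #|I|%:R; have d0 : 0 <= d by rewrite ler0n.
(* The smoothing costs at most ln (1 + d t) <= d t, and this [t] keeps d t below [e]. *)
pose t := e / (d + 1); have t0 : 0 < t by rewrite divr_gt0 //; lra.
have dt : d * t <= e.
  by rewrite /t mulrA ler_pdivrMr ?ltr_wpDl // mulrC ler_wpM2l ?(ltW e0) // lerDl.
have dt0 : 0 <= d * t by rewrite mulr_ge0 // ltW.
have mt j : 0 < mu j + t by have := mu0 j; lra.
exists b, (fun j => ln (1 + d * t) - ln (mu j + t)); split.
- exact: Ab.1.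
- have dt1 : 0 < 1 + d * t by lra.
  rewrite (eq_bigr (fun j => (mu j + t) * (1 + d * t)^-1)); last first.
    by move=> j _; rewrite opprB expRD expRN !lnK // posrE.
  by rewrite -mulr_suml big_split /= mu1 sumr_const -[t *+ _]mulr_natl -/d divff //
    gt_eqF.
rewrite (ln2_entropy Ad.1 Ab).
have -> : \sum_j (ln (1 + d * t) - ln (mu j + t)) * complex.Re (qf A (b j)) =
    ln (1 + d * t) - \sum_j mu j * ln (mu j + t).
  transitivity (\sum_j (mu j * ln (1 + d * t) - mu j * ln (mu j + t))).
    by apply: eq_bigr => j _; rewrite (eigd_qf _ Ab) /=; ring.
  by rewrite sumrB -mulr_suml mu1 mul1r.
have l1 : ln (1 + d * t) <= d * t by apply: le_ln1Dx; lra.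
suff : \sum_j mu j * ln (mu j) <= \sum_j mu j * ln (mu j + t) by lra.
apply: ler_sum => j _; have [->|mn] := eqVneq (mu j) 0; first by rewrite !mul0r.
have mp : 0 < mu j by rewrite lt_neqAle eq_sym mn mu0.
by rewrite ler_wpM2l // ler_ln ?posrE ?mt // lerDl ltW.
Qed.

(** Once the entropy of the mixture is replaced by a functional linear in the state, the whole
    Holevo quantity has a majorant linear in p, tight at [p0] up to [e]. *)
Lemma chi_usc (X J : finType) (tau : X -> op R J) (p0 : X -> R) (e : R) :
  (forall x, density (tau x)) -> pmf p0 -> 0 < e ->
  exists h : X -> R, (forall p, pmf p -> chi p tau <= \sum_x p x * h x) /\
    \sum_x p0 x * h x <= chi p0 tau + e.
Proof.
move=> td p0P e0; have l2 := ln2_gt0 R.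
have [b [c [bo c1 cE]]] :=
  entropy_cross_attained (density_mix p0P td) (mulr_gt0 l2 e0).
pose h x := (ln 2)^-1 * \sum_j c j * complex.Re (qf (tau x) (b j)) - vN_entropy (tau x).
have hE p : pmf p -> \sum_x p x * h x = (ln 2)^-1 *
    \sum_j c j * complex.Re (qf (mixop p tau) (b j)) - \sum_x p x * vN_entropy (tau x).
  move=> pP; under eq_bigr do rewrite /h mulrBr.
  rewrite sumrB; congr (_ - _).
  under eq_bigr do rewrite mulrCA mulr_sumr.
  rewrite -mulr_sumr exchange_big /=; congr (_ * _); apply: eq_bigr => j _.
  under eq_bigr do rewrite mulrCA.
  rewrite -mulr_sumr; congr (_ * _); apply: RtoC_inj.
  rewrite RtoC_Re; last exact: (density_mix pP td).1.
  rewrite qf_mix rmorph_sum; apply: eq_bigr => x _.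
  by rewrite rmorphM /= RtoC_Re //; apply: (td x).1.
exists h; split=> [p pP|].
  rewrite (hE p pP) /chi lerD2r -(ler_pM2l l2) mulVKf ?gt_eqF //.
  exact: entropy_le_cross (density_mix pP td) bo c1.
rewrite (hE p0 p0P) /chi addrAC lerD2r -(ler_pM2l l2) mulVKf ?gt_eqF //.
by rewrite mulrDr.
Qed.

(** Upper semicontinuity stated without a topology: at every point there is a bilinear majorant,
    tight up to [e]. Such a majorant is a polynomial in the probabilities, hence continuous. *)
Definition bilin_usc (X1 X2 : finType) (g : (X1 -> R) -> (X2 -> R) -> R) : Prop :=
  forall p0 p0' (e : R), pmf p0 -> pmf p0' -> 0 < e ->
  exists H : X1 -> X2 -> R,
    (forall p p', pmf p -> pmf p' ->
       g p p' <= \sum_x1 \sum_x2 p x1 * p' x2 * H x1 x2) /\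
    \sum_x1 \sum_x2 p0 x1 * p0' x2 * H x1 x2 <= g p0 p0' + e.

Section Channel.
Variables (X1 X2 J1 J2 : finType) (rho : X1 -> X2 -> op R (J1 * J2)%type).
Hypothesis rho_cq : cq_ic rho.

Lemma holevo1_usc : bilin_usc (holevo1 rho).
Proof.
move=> p0 p0' e pP pP' e0.
have md x1 x2 : density (marg1 (rho x1 x2)) by apply/density_marg1/rho_cq.
have [h hP] := boolp.choice (fun x2 => chi_usc (fun x1 => md x1 x2) pP e0).
have E p p' : \sum_x1 \sum_x2 p x1 * p' x2 * h x2 x1 =
    \sum_x2 p' x2 * \sum_x1 p x1 * h x2 x1.
  rewrite exchange_big; apply: eq_bigr => x2 _; rewrite mulr_sumr.
  by apply: eq_bigr => x1 _; ring.
exists (fun x1 x2 => h x2 x1); split=> [p p' q q'|]; rewrite E /holevo1.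
  by apply: ler_sum => x2 _; rewrite ler_wpM2l ?q'.1 // (hP x2).1.
rewrite -[e]mul1r -pP'.2 mulr_suml -big_split; apply: ler_sum => x2 _ /=.
by rewrite -mulrDr ler_wpM2l ?pP'.1 // (hP x2).2.
Qed.

Lemma holevo2_usc : bilin_usc (holevo2 rho).
Proof.
move=> p0 p0' e pP pP' e0.
have md x1 x2 : density (marg2 (rho x1 x2)) by apply/density_marg2/rho_cq.
have [h hP] := boolp.choice (fun x1 => chi_usc (md x1) pP' e0).
have E p p' : \sum_x1 \sum_x2 p x1 * p' x2 * h x1 x2 =
    \sum_x1 p x1 * \sum_x2 p' x2 * h x1 x2.
  apply: eq_bigr => x1 _; rewrite mulr_sumr.
  by apply: eq_bigr => x2 _; ring.
exists h; split=> [p p' q q'|]; rewrite E /holevo2.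
  by apply: ler_sum => x1 _; rewrite ler_wpM2l ?q.1 // (hP x1).1.
rewrite -[e]mul1r -pP.2 mulr_suml -big_split; apply: ler_sum => x1 _ /=.
by rewrite -mulrDr ler_wpM2l ?pP.1 // (hP x1).2.
Qed.

Lemma holevo12_usc : bilin_usc (holevo12 rho).
Proof.
move=> p0 p0' e pP pP' e0.
have [h [h1 h2]] := chi_usc (fun x : X1 * X2 => rho_cq x.1 x.2) (pmf_prod pP pP') e0.
exists (fun x1 x2 => h (x1, x2)); split=> [p p' q q'|].
  by have := h1 _ (pmf_prod q q'); rewrite sum_pair.
by move: h2; rewrite sum_pair.
Qed.

End Channel.
End Semicontinuity.

(** * Caratheodory's theorem for finite convex combinations *)

Section Caratheodory.
Variable R : realType.

(** The extended rows (v_i, 1) live in dimension d + 1, so more than d + 1 of them are linearly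
    dependent; the last coordinate says that the coefficients sum to 0. A nonzero family with sum 0
    has a positive member. *)
Lemma affine_dependence m d (v : 'I_m -> 'rV[R]_d) : (d.+1 < m)%N ->
  exists al : 'I_m -> R, [/\ \sum_i al i = 0, \sum_i al i *: v i = 0 &
    exists i, 0 < al i].
Proof.
move=> dm; pose M := \matrix_(i < m) row_mx (v i) (1 : 'rV[R]_1).
have : kermx M != 0.
  rewrite -mxrank_eq0 mxrank_ker subn_eq0 -ltnNge.
  by apply: leq_ltn_trans (rank_leq_col _) _; rewrite addn1.
case/rowV0Pn=> u /sub_kermxP uM un0; pose al i := u 0 i.
have uE : \sum_i al i *: row_mx (v i) (1 : 'rV[R]_1) = 0.
  rewrite -[RHS]uM mulmx_sum_row.
  by apply: eq_bigr => i _; rewrite rowK.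
have a1 : \sum_i al i = 0.
  have /(f_equal (fun w => rsubmx w 0 0)) := uE.
  rewrite linear_sum linear0 summxE mxE => E; rewrite -[RHS]E.
  by apply: eq_bigr => i _; rewrite linearZ /= row_mxKr !mxE mulr1.
have a2 : \sum_i al i *: v i = 0.
  have /(f_equal lsubmx) := uE; rewrite linear_sum linear0 => E; rewrite -[RHS]E.
  by apply: eq_bigr => i _; rewrite linearZ /= row_mxKl.
exists al; split=> //; apply/existsP; apply: contraNT un0 => /existsPn h.
have al0 i : 0 <= - al i by rewrite oppr_ge0 leNgt h.
have /eqP : \sum_i - al i = 0 by rewrite sumrN a1 oppr0.
rewrite psumr_eq0 // => /allP z; apply/eqP/rowP => i; rewrite mxE.
by apply/eqP; rewrite -oppr_eq0; apply: z; rewrite mem_index_enum.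
Qed.

(** Induction on the number of points: while there are more than d + 1, the weights are moved along
    an affine dependence until one vanishes, and that point is dropped. *)
Lemma caratheodory_ord d m (p : 'I_m -> R) (v : 'I_m -> 'rV[R]_d) : pmf p ->
  exists (p' : 'I_d.+1 -> R) (f : 'I_d.+1 -> 'I_m),
    pmf p' /\ \sum_i p' i *: v (f i) = \sum_i p i *: v i.
Proof.
elim: m p v => [|m IH] p v [p0 p1].
  by move: p1; rewrite big_ord0 => /eqP; rewrite eq_sym oner_eq0.
have [md|dm] := leqP m.+1 d.+1.
  (* Few points: pad with zero weights up to d + 1. The default value of [inord] is harmless
     there. *)
  pose f (i : 'I_d.+1) : 'I_m.+1 := inord i.
  pose p' (i : 'I_d.+1) : R := if (i < m.+1)%N then p (f i) else 0.
  have sumE (V : lmodType R) (F : 'I_m.+1 -> V) :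
      \sum_i p' i *: F (f i) = \sum_i p i *: F i.
    pose G k := p (inord k) *: F (inord k).
    rewrite (eq_bigr (fun i : 'I_m.+1 => G i)); last by move=> i _; rewrite /G inord_val.
    rewrite (big_ord_widen _ G md) [RHS]big_mkcond; apply: eq_bigr => i _.
    by rewrite /p' /G /f; case: ifP => //; rewrite scale0r.
  exists p', f; split; last exact: sumE.
  split=> [i|]; first by rewrite /p'; case: ifP.
  have := sumE R^o (fun=> 1); rewrite /GRing.scale /= => E.
  rewrite -p1; under eq_bigr do rewrite -[p' _]mulr1.
  by rewrite E; under eq_bigr do rewrite mulr1.
have [al [a1 a2 [i0 ai0]]] := affine_dependence v dm.
(* The smallest ratio is the largest step that keeps all weights nonnegative; the weight at [k]
   becomes 0. *)
pose k := [arg min_(i < i0 | 0 < al i) (p i / al i)]%O.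
have [ak kmin] : 0 < al k /\ forall i, 0 < al i -> p k / al k <= p i / al i.
  by rewrite /k; case: arg_minP.
pose t := p k / al k; pose q i := p i - t * al i.
have t0 : 0 <= t by rewrite divr_ge0 // ltW.
have qk : q k = 0 by rewrite /q /t; field; rewrite gt_eqF.
have q0 i : 0 <= q i.
  rewrite /q subr_ge0; have [ai|ai] := ltP 0 (al i).
    by rewrite -ler_pdivlMr // kmin.
  by apply: le_trans (p0 i); rewrite mulr_ge0_le0.
have q1 : \sum_i q i = 1 by rewrite sumrB p1 -mulr_sumr a1 mulr0 subr0.
have qv : \sum_i q i *: v i = \sum_i p i *: v i.
  under eq_bigr do rewrite scalerBl -scalerA.
  by rewrite sumrB -scaler_sumr a2 scaler0 subr0.
have [|p' [f [p'P E]]] := IH (fun i => q (lift k i)) (fun i => v (lift k i)).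
  split=> [i|]; first exact: q0.
  by rewrite -q1 (bigD1_ord k) //= qk add0r.
exists p', (fun i => lift k (f i)); split=> //.
by rewrite E -qv [RHS](bigD1_ord k) //= qk scale0r add0r.
Qed.

Lemma caratheodory (Q : finType) d (p : Q -> R) (v : Q -> 'rV[R]_d) : pmf p ->
  exists (p' : 'I_d.+1 -> R) (f : 'I_d.+1 -> Q),
    pmf p' /\ \sum_i p' i *: v (f i) = \sum_q p q *: v q.
Proof.
move=> [p0 p1]; have bij := onW_bij predT (enum_val_bij Q).
have pP : pmf (fun i => p (@enum_val Q Q i)).
  by split=> [i|]; [exact: p0|rewrite -p1 [RHS](reindex (@enum_val Q Q))].
have [p' [f [p'P E]]] := caratheodory_ord (fun i => v (enum_val i)) pP.
exists p', (fun i => enum_val (f i)); split=> //.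
by rewrite E [RHS](reindex (@enum_val Q Q)).
Qed.

End Caratheodory.

(** * Compactness of the time-sharing parameters *)

Section Closedness.
Variable R : realType.

Lemma continuous_sumr (T : topologicalType) (I : finType) (F : I -> T -> R) :
  (forall i, continuous (F i)) -> continuous (fun v => \sum_i F i v).
Proof.
move=> Fc; elim: (index_enum I) => [|i s IH].
  by under eq_fun do rewrite big_nil; apply: cst_continuous.
under eq_fun do rewrite big_cons.
by move=> v; apply: continuousD; [exact: Fc|exact: IH].
Qed.

Lemma continuous_mulr (T : topologicalType) (f g : T -> R) :
  continuous f -> continuous g -> continuous (fun v => f v * g v).
Proof. by move=> fc gc v; exact: (continuousM (fc v) (gc v)). Qed.

(** Otherwise f < c on a neighbourhood of [v], which meets every tail of the sequence. *)
Lemma cluster_le (T : topologicalType) (w : nat -> T) (v : T) (f : T -> R) (c : R)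
    (m0 : nat) :
  cluster (w @ \oo) v -> continuous f -> (forall m, (m0 <= m)%N -> c <= f (w m)) ->
  c <= f v.
Proof.
move=> cl fc fw; rewrite leNgt; apply/negP => fv.
have nb : nbhs v [set u | f u < c].
  by apply: (fc v [set y | y < c]); apply: open_nbhs_nbhs; split=> //; apply: open_lt.
have [|u [[m /= mm <-] /=]] := cl [set w m | m in [set m | (m0 <= m)%N]] _ _ nb.
  by exists m0 => // m /= mm; exists m.
by rewrite ltNge fw.
Qed.

(** Parameters for the tolerances 1/(m+1), cut down to d + 1 time-sharing letters, form a sequence
    in a compact cube. A cluster point satisfies the normalizations by continuity and the rate
    bounds through continuous majorants tight at that point. *)
Lemma usc_hull_closed (X1 X2 : finType) (d : nat)
    (g : 'I_d -> (X1 -> R) -> (X2 -> R) -> R) (r : 'I_d -> R) :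
  (forall i, bilin_usc (g i)) ->
  (forall e, 0 < e -> exists (Q : finType) pQ (p1 : Q -> X1 -> R) (p2 : Q -> X2 -> R),
     [/\ pmf pQ, forall q, pmf (p1 q), forall q, pmf (p2 q) &
      forall i, r i - e <= \sum_q pQ q * g i (p1 q) (p2 q)]) ->
  exists pQ (p1 : 'I_d.+1 -> X1 -> R) (p2 : 'I_d.+1 -> X2 -> R),
     [/\ pmf pQ, forall q, pmf (p1 q), forall q, pmf (p2 q) &
      forall i, r i <= \sum_q pQ q * g i (p1 q) (p2 q)].
Proof.
move=> gu app; pose D := 'I_d.+1.
pose good e (P : (D -> R) * (D -> X1 -> R) * (D -> X2 -> R)) :=
  [/\ pmf P.1.1, forall q, pmf (P.1.2 q), forall q, pmf (P.2 q) &
      forall i, r i - e <= \sum_q P.1.1 q * g i (P.1.2 q) (P.2 q)].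
have ex (m : nat) : exists P, good m.+1%:R^-1 P.
  have [|Q [pQ [p1 [p2 [pQP p1P p2P rP]]]]] := app m.+1%:R^-1.
    by rewrite invr_gt0.
  have [pD [f [pDP E]]] := caratheodory (fun q => \row_i g i (p1 q) (p2 q)) pQP.
  exists (pD, p1 \o f, p2 \o f); split=> //= i.
  have vE (S : finType) (p : S -> R) (h : S -> Q) :
      (\sum_s p s *: (\row_i g i (p1 (h s)) (p2 (h s)))) 0 i =
      \sum_s p s * g i (p1 (h s)) (p2 (h s)).
    by rewrite summxE; apply: eq_bigr => s _; rewrite !mxE.
  by apply: le_trans (rP i) _; rewrite -(vE _ pD f) E (vE _ pQ id).
have [P PP] := boolp.choice ex.
(* [T] lists all scalar parameters, so that a full choice of distributions becomes one row
   vector. *)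
pose T := (D + (D * X1) + (D * X2))%type.
pose enc (p : (D -> R) * (D -> X1 -> R) * (D -> X2 -> R)) (t : T) : R :=
  match t with
  | inl (inl q) => p.1.1 q
  | inl (inr qx) => p.1.2 qx.1 qx.2
  | inr qx => p.2 qx.1 qx.2
  end.
pose w m : 'rV[R]_#|{: T}| := \row_k enc (P m) (enum_val k).
pose c (t : T) (v : 'rV[R]_#|{: T}|) : R := v ord0 (enum_rank t).
have cw t m : c t (w m) = enc (P m) t by rewrite /c mxE enum_rankK.
have cc t : continuous (c t) by apply: coord_continuous.
have pmf01 (S : finType) (p : S -> R) x : pmf p -> 0 <= p x <= 1.
  move=> [p0 p1]; rewrite p0 -p1 (bigD1 x) //= lerDl.
  exact: sumr_ge0.
pose B := [set v : 'rV[R]_#|{: T}| | forall i, `[0, 1]%classic (v ord0 i)].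
have Bc : compact B.
  exact: (@rV_compact R _ (fun=> `[0, 1]%classic) (fun=> @segment_compact R 0 1)).
have [|v [Bv cl]] := Bc (w @ \oo) _.
  exists 0%N => // m _ i /=; rewrite mxE in_itv /=.
  have [h1 h2 h3 _] := PP m.
  by case: (enum_val i) => [[q|[q x]]|[q x]] /=; apply: pmf01.
have c0 t : 0 <= c t v.
  by have := Bv (enum_rank t); rewrite /= in_itv => /andP[].
(* [cluster_le] preserves lower bounds, so the equality is passed to the limit as two
   inequalities. *)
have sum_eq1 (S : finType) (e : S -> T) :
    (forall m, \sum_x c (e x) (w m) = 1) -> \sum_x c (e x) v = 1.
  move=> H; have sc : continuous (fun u => \sum_x c (e x) u) by apply: continuous_sumr.
  apply/eqP; rewrite eq_le; apply/andP; split; last first.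
    by apply: (cluster_le (m0 := 0%N) cl sc) => m _; rewrite H.
  rewrite -lerN2; apply: (cluster_le (m0 := 0%N) (f := fun u => - \sum_x c (e x) u) cl).
    by move=> u; apply: continuousN; apply: sc.
  by move=> m _; rewrite H.
pose pQ q := c (inl (inl q)) v; pose p1 q x := c (inl (inr (q, x))) v.
pose p2 q x := c (inr (q, x)) v.
have pQP : pmf pQ.
  split=> [q|]; first exact: c0.
  apply: (sum_eq1 _ (fun q => inl (inl q))) => m.
  by under eq_bigr do rewrite cw; have [[]] := PP m.
have p1P q : pmf (p1 q).
  split=> [x|]; first exact: c0.
  apply: (sum_eq1 _ (fun x => inl (inr (q, x)))) => m.
  by under eq_bigr do rewrite cw; have [_ /(_ q)[]] := PP m.
have p2P q : pmf (p2 q).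
  split=> [x|]; first exact: c0.
  apply: (sum_eq1 _ (fun x => inr (q, x))) => m.
  by under eq_bigr do rewrite cw; have [_ _ /(_ q)[]] := PP m.
exists pQ, p1, p2; split=> // i; apply/ler_addgt0Pr => e e0.
have e2 : 0 < e / 2 by rewrite divr_gt0.
have [H HP] := boolp.choice (fun q => gu i _ _ _ (p1P q) (p2P q) e2).
(* The majorant of the i-th rate bound, with coefficients chosen tight at the limit up to e / 2; the
   other e / 2 pays for the tolerance 1/(m+1) at large m. *)
pose f u := \sum_q c (inl (inl q)) u * \sum_x1 \sum_x2
  (c (inl (inr (q, x1))) u * c (inr (q, x2)) u * H q x1 x2).
have fc : continuous f.
  apply: continuous_sumr => q; apply: continuous_mulr; first exact: cc.
  apply: continuous_sumr => x1; apply: continuous_sumr => x2.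
  apply: continuous_mulr; last exact: cst_continuous.
  by apply: continuous_mulr; apply: cc.
have [m0 hm0] : exists m0, forall m, (m0 <= m)%N -> m.+1%:R^-1 <= e / 2.
  exists (Num.truncn (e / 2)^-1) => m mm.
  rewrite invf_ple ?posrE // ltW //; apply: lt_le_trans (truncnS_gt _) _.
  by rewrite ler_nat.
have fv : r i - e / 2 <= f v.
  apply: (cluster_le cl fc) => m /hm0 mm; have [h1 h2 h3 h4] := PP m.
  apply: (@le_trans _ _ (r i - m.+1%:R^-1)); first by rewrite lerD2l lerN2.
  apply: le_trans (h4 i) _; rewrite /f; apply: ler_sum => q _.
  rewrite cw /= ler_wpM2l ?h1.1 //; apply: le_trans ((HP q).1 _ _ (h2 q) (h3 q)) _.
  by apply: ler_sum => x1 _; apply: ler_sum => x2 _; rewrite !cw.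
suff : f v <= \sum_q pQ q * g i (p1 q) (p2 q) + e / 2.
  by move: fv; set y := f v; set z := \sum_q _; clearbody y z; lra.
rewrite -[X in _ + X]mul1r -[X in X * _]pQP.2 mulr_suml -big_split.
apply: ler_sum => q _ /=.
rewrite -mulrDr; apply: ler_wpM2l; first exact: pQP.1.
exact: (HP q).2.
Qed.

End Closedness.

(** * From achievable rates to the Sato region *)

Section Main.
Variable R : realType.

(** One [eta] absorbs the factor 1 - 4 * [eps], which costs 4 * [eps] * |x|; the other absorbs the
    constant 1 - ln [eps], which is divided by n. *)
Lemma rate_bound (n : nat) (eps eta x M S : R) :
  0 < eps -> 4 * eps <= 1 -> 0 < M -> n%:R * x * ln 2 <= ln M ->
  4 * eps * `|x| <= eta -> 1 - ln eps <= n%:R * ln 2 * eta ->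
  ln (eps * M) * (1 - 4 * eps) <= 1 + ln 2 * S ->
  n%:R * (x - 2 * eta) <= S.
Proof.
move=> e0 e4 M0 lM xe ne; rewrite lnM ?posrE // => H.
have l2 := ln2_gt0 R; have n0 : 0 <= n%:R :> R by rewrite ler0n.
have le : ln eps <= 0 by apply: ln_le0; lra.
have e1 : 0 <= 1 - 4 * eps by lra.
rewrite -(ler_pM2r l2).
have h1 : n%:R * x * ln 2 * (1 - 4 * eps) <= ln M * (1 - 4 * eps) by rewrite ler_wpM2r.
have h2 : ln eps <= ln eps * (1 - 4 * eps).
  have : 0 <= - ln eps * (4 * eps) by rewrite mulr_ge0; lra.
  lra.
have h3 : n%:R * ln 2 * (4 * eps * x) <= n%:R * ln 2 * eta.
  rewrite ler_wpM2l ?mulr_ge0 ?(ltW l2) //; apply: le_trans xe.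
  by rewrite ler_wpM2l ?ler_norm //; lra.
move: H h1 h2 h3 ne; set a := ln eps; set b := ln M; set l := ln 2; set m := n%:R.
lra.
Qed.

(** The time-sharing variable is the channel use, uniform on n values. Individual rates lose one
    [eta] as the rate slack of the code and two in [rate_bound]; the sum rate incurs the slack
    twice. *)
Lemma achievable_approx (X1 X2 J1 J2 : finType) (rho : X1 -> X2 -> op R (J1 * J2)%type)
    (r : R * R) (eta : R) : cq_ic rho -> achievable rho r -> 0 < eta ->
  exists (Q : finType) pQ (p1 : Q -> X1 -> R) (p2 : Q -> X2 -> R),
    [/\ pmf pQ, forall q, pmf (p1 q), forall q, pmf (p2 q) &
      [/\ r.1 - 3 * eta <= \sum_q pQ q * holevo1 rho (p1 q) (p2 q),
          r.2 - 3 * eta <= \sum_q pQ q * holevo2 rho (p1 q) (p2 q) &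
          r.1 + r.2 - 4 * eta <= \sum_q pQ q * holevo12 rho (p1 q) (p2 q)]].
Proof.
move=> rho_cq rach eta0; have l2 := ln2_gt0 R.
pose x1 := r.1 - eta; pose x2 := r.2 - eta.
(* [K] dominates |x1|, |x2| and |x1 + x2|, and [eps] is chosen so that 4 * [eps] * [K] = [eta]. The
   extra [eta] makes [K] positive and forces 4 * [eps] <= 1. *)
pose K : R := `|x1| + `|x2| + eta.
have K0 : 0 < K by rewrite ltr_wpDl // addr_ge0.
pose eps := eta / (4 * K).
have e0 : 0 < eps by rewrite divr_gt0 // mulr_gt0.
have eK : 4 * eps * K = eta by rewrite /eps; field; rewrite gt_eqF.
have e4 : 4 * eps <= 1.
  by rewrite -(ler_pM2r K0) eK mul1r /K lerDr addr_ge0.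
have eX x : `|x| <= `|x1| + `|x2| -> 4 * eps * `|x| <= eta.
  move=> xx; rewrite -[leRHS]eK ler_wpM2l //; first by rewrite mulr_ge0 // ltW.
  by rewrite /K; apply: le_trans xx _; rewrite lerDl ltW.
have [N HN] := rach eps eta e0 eta0.
(* Beyond the threshold of the code sequence, positive, and large enough that (1 - ln [eps]) / n is
   at most ln 2 * [eta]. *)
pose n := maxn N.+1 (Num.truncn ((1 - ln eps) / (ln 2 * eta))).+1.
have n0 : (0 < n)%N by rewrite leq_max.
have nR : 0 < n%:R :> R by rewrite ltr0n.
have nE : 1 - ln eps <= n%:R * ln 2 * eta.
  rewrite -mulrA -ler_pdivrMr ?mulr_gt0 // ltW //; apply: lt_le_trans (truncnS_gt _) _.
  by rewrite ler_nat leq_maxr.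
have [|M1 [M2 [c1 [c2 [L [G [hM1 hM2 Lp Gp err]]]]]]] := HN n.
  by apply: leq_trans (leq_maxl _ _).
have pos M y : powR 2 y <= M%:R :> R -> (0 < M)%N.
  by move=> h; rewrite -(ltr0n R); apply: lt_le_trans h; apply: powR_gt0.
have M10 := pos _ _ hM1; have M20 := pos _ _ hM2.
have M10R : 0 < M1%:R :> R by rewrite ltr0n.
have M20R : 0 < M2%:R :> R by rewrite ltr0n.
have rlnM M x : (0 < M)%N -> powR 2 (n%:R * x) <= M%:R -> n%:R * x * ln 2 <= ln M%:R :> R.
  by move=> M0 h; rewrite -ln_powR ler_ln // posrE ?powR_gt0 ?ltr0n.
have [b1 b2 b12] := code_bounds rho_cq M10 M20 e0 e4 Lp Gp err.
have up (x S : R) : n%:R * (x - 2 * eta) <= S -> x - 2 * eta <= n%:R^-1 * S.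
  by move=> h; rewrite -(ler_pM2l nR) mulVKf ?gt_eqF.
exists 'I_n, (fun=> n%:R^-1), (fun k => emp R (fun m => c1 m k)).
exists (fun k => emp R (fun m => c2 m k)).
split.
- split=> [k|]; first by rewrite invr_ge0 ltW.
  by rewrite sumr_const card_ord -[LHS]mulr_natl divff // gt_eqF.
- by move=> k; apply: emp_pmf; rewrite card_ord.
- by move=> k; apply: emp_pmf; rewrite card_ord.
rewrite -!mulr_sumr; split.
- rewrite (_ : r.1 - 3 * eta = x1 - 2 * eta); last by rewrite /x1; ring.
  apply: up; apply: (rate_bound e0 e4 M10R (rlnM _ _ M10 hM1)) b1 => //.
  by apply: eX; rewrite lerDl.
- rewrite (_ : r.2 - 3 * eta = x2 - 2 * eta); last by rewrite /x2; ring.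
  apply: up; apply: (rate_bound e0 e4 M20R (rlnM _ _ M20 hM2)) b2 => //.
  by apply: eX; rewrite lerDr.
rewrite (_ : r.1 + r.2 - 4 * eta = (x1 + x2) - 2 * eta); last by rewrite /x1 /x2; ring.
apply: up; apply: (rate_bound e0 e4 _ _ _ nE b12).
- by rewrite natrM mulr_gt0.
- rewrite natrM lnM ?posrE // mulrDr mulrDl lerD //; exact: rlnM.
by apply: eX; apply: ler_normD.
Qed.

End Main.

Theorem theorem4 (R : realType) (X1 X2 J1 J2 : finType)
    (rho : X1 -> X2 -> op R (J1 * J2)%type) :
  cq_ic rho -> capacity_region rho `<=` sato_region rho.
Proof.
move=> rho_cq r rcl.
pose g (i : 'I_3) := nth (holevo1 rho) [:: holevo1 rho; holevo2 rho; holevo12 rho] i.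
pose s (i : 'I_3) := nth 0 [:: r.1; r.2; r.1 + r.2] i.
have gu i : bilin_usc (g i).
  case: i => -[|[|[|]]] //= ?.
  - exact: holevo1_usc.
  - exact: holevo2_usc.
  - exact: holevo12_usc.
have [e e0|pQ [p1 [p2 [pQP p1P p2P rP]]]] := @usc_hull_closed R X1 X2 3 g s gu.
  (* The worst case is the sum rate: approximating both coordinates by an achievable pair costs 2 *
     [eta], and [achievable_approx] another 4 * [eta]. *)
  pose eta := e / 6; have eta0 : 0 < eta by rewrite divr_gt0.
  have [r' [ra [/= rb1 rb2]]] := rcl _ (nbhsx_ballx r eta eta0).
  have [Q [pQ [p1 [p2 [pQP p1P p2P [h1 h2 h3]]]]]] := achievable_approx rho_cq ra eta0.
  move: rb1 rb2; rewrite /ball /= => /ltW rb1 /ltW rb2.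
  move: rb1 rb2; rewrite !ler_norml => /andP[_ k1] /andP[_ k2].
  have eE : e = 6 * eta by rewrite /eta; field.
  exists Q, pQ, p1, p2; split=> // -[[|[|[|]]] //= ?]; rewrite /s /g /= eE.
  - by apply: le_trans h1; lra.
  - by apply: le_trans h2; lra.
  - by apply: le_trans h3; lra.
exists 'I_4, pQ, p1, p2; split; first by split.
rewrite I_X1_B1_holevo // I_X2_B2_holevo // I_X1X2_B1B2_holevo //; split.
- exact: (rP (@Ordinal 3 0 isT)).
- exact: (rP (@Ordinal 3 1 isT)).
- exact: (rP (@Ordinal 3 2 isT)).
Qed.
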